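(* Let $n\geq 3$ be an integer, and suppose that the dihedral group $D_{2n}$ of order $2n$ is a Schur group. Then $|\pi(n)|\leq 3$. Moreover: (1) if $|\pi(n)|=2$, then $n$ is a product of a prime and a power of an odd prime, or $n=12$; (2) if $|\pi(n)|=3$, then $n$ is a product of three primes.
   Context: $\pi(n)$ denotes the set of prime divisors of $n$. S-rings and Schur groups: let $G$ be a finite group with identity $e$, and for $X\subseteq G$ put $\underline{X}=\sum_{x\in X}x\in\mathbb{Z}G$. A subring $\mathcal{A}\subseteq\mathbb{Z}G$ is an S-ring over $G$ if there is a partition $\mathcal{S}(\mathcal{A})$ of $G$ such that $\{e\}\in\mathcal{S}(\mathcal{A})$; $X\in\mathcal{S}(\mathcal{A})$ implies $X^{-1}=\{x^{-1}:x\in X\}\in\mathcal{S}(\mathcal{A})$; and $\mathcal{A}=\mathrm{Span}_{\mathbb{Z}}\{\underline{X}:X\in\mathcal{S}(\mathcal{A})\}$. Let $G_r\leq\mathrm{Sym}(G)$ be the group of all right translations $x\mapsto xg$, $g\in G$. For every $K$ with $G_r\leq K\leq \mathrm{Sym}(G)$, the orbits on $G$ of the stabilizer $K_e$ form the partition of an S-ring, denoted $V(K,G)$. An S-ring $\mathcal{A}$ over $G$ is schurian if $\mathcal{A}=V(K,G)$ for some $K$ with $G_r\leq K\leq\mathrm{Sym}(G)$. The group $G$ is a Schur group if every S-ring over $G$ is schurian. *)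

(* Defs.v *)
From HB Require Import structures.
From mathcomp Require Import all_boot all_order all_fingroup all_algebra.
From mathcomp Require Import all_solvable.

Set Implicit Arguments.
Unset Strict Implicit.
Unset Printing Implicit Defensive.

Import GRing.Theory.
Local Open Scope group_scope.
Local Open Scope ring_scope.

(* The integral group ring ZG, with G the whole of gT. A dedicated alias is
   needed since its product is the convolution, not the pointwise product. *)
Definition zgring (gT : finGroupType) := {ffun gT -> int}.

HB.instance Definition _ (gT : finGroupType) := GRing.Zmodule.on (zgring gT).

Section GroupRing.

Variable gT : finGroupType.
Implicit Types a b c : zgring gT.

Definition zg_elt (x : gT) : zgring gT := [ffun g => (g == x)%:R].

Definition zg_mul a b : zgring gT :=
  [ffun g => \sum_(h : gT) a h * b (h^-1 * g)%g].

Fact zg_mulE a b g : zg_mul a b g = \sum_(h : gT) a h * b (h^-1 * g)%g.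
Proof. by rewrite ffunE. Qed.

Fact zg_eltE (x g : gT) : zg_elt x g = (g == x)%:R.
Proof. by rewrite ffunE. Qed.

Fact zg_mulA : associative zg_mul.
Proof.
move=> a b c; apply/ffunP=> g; rewrite !zg_mulE.
under eq_bigr do rewrite zg_mulE big_distrr /=.
under [RHS]eq_bigr do rewrite zg_mulE big_distrl /=.
rewrite [RHS]exchange_big; apply: eq_bigr => h _.
rewrite [RHS](reindex_inj (mulgI h)) /=; apply: eq_bigr => k _.
by rewrite mulrA mulKg invMg mulgA.
Qed.

Fact zg_mul1l : left_id (zg_elt 1%g) zg_mul.
Proof.
move=> a; apply/ffunP=> g; rewrite zg_mulE (bigD1 1%g) //= zg_eltE eqxx mul1r.
rewrite invg1 mul1g big1 ?addr0 // => h /negbTE h1.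
by rewrite zg_eltE h1 mul0r.
Qed.

Fact zg_mul1r : right_id (zg_elt 1%g) zg_mul.
Proof.
move=> a; apply/ffunP=> g.
rewrite zg_mulE (bigD1 g) //= zg_eltE mulVg eqxx mulr1.
rewrite big1 ?addr0 // => h neq_hg; rewrite zg_eltE -eq_mulVg1.
by rewrite (negbTE neq_hg) mulr0.
Qed.

Fact zg_mulDl : left_distributive zg_mul +%R.
Proof.
move=> a b c; apply/ffunP=> g; rewrite [RHS]ffunE !zg_mulE -big_split /=.
by apply: eq_bigr => h _; rewrite ffunE mulrDl.
Qed.

Fact zg_mulDr : right_distributive zg_mul +%R.
Proof.
move=> a b c; apply/ffunP=> g; rewrite [RHS]ffunE !zg_mulE -big_split /=.
by apply: eq_bigr => h _; rewrite ffunE mulrDr.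
Qed.

Fact zg_elt1_neq0 : zg_elt 1%g != 0.
Proof. by apply/eqP=> /ffunP/(_ 1%g); rewrite zg_eltE ffunE eqxx. Qed.

HB.instance Definition _ := GRing.Zmodule_isNzRing.Build (zgring gT)
  zg_mulA zg_mul1l zg_mul1r zg_mulDl zg_mulDr zg_elt1_neq0.

Fact zg_eltM (x y : gT) : zg_elt (x * y)%g = zg_elt x * zg_elt y.
Proof.
apply/ffunP=> g; rewrite [RHS]zg_mulE (bigD1 x) //= !zg_eltE eqxx mul1r.
rewrite big1 ?addr0 => [|h /negbTE nhx]; last by rewrite zg_eltE nhx mul0r.
by rewrite -[(_ * g)%g == y](inj_eq (mulgI x)) mulKVg.
Qed.

(* The element \underline{X} of ZG. *)
Definition simple_quantity (X : {set gT}) : zgring gT :=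
  \sum_(x in X) zg_elt x.

Definition is_subring (A : zgring gT -> Prop) : Prop :=
  [/\ A 1, forall a b, A a -> A b -> A (a - b)
         & forall a b, A a -> A b -> A (a * b)].

Definition zspan (S : {set {set gT}}) (a : zgring gT) : Prop :=
  exists c : {set gT} -> int, a = \sum_(X in S) simple_quantity X *~ c X.

Definition is_Sring (A : zgring gT -> Prop) : Prop :=
  is_subring A /\
  exists S : {set {set gT}},
    [/\ partition S [set: gT],
        [set 1%g] \in S,
        forall X : {set gT}, X \in S -> X^-1%g \in S
      & forall a, A a <-> zspan S a].

Definition right_translations : {set {perm gT}} :=
  [set perm (mulIg g) | g : gT].

Definition stab1_orbits (K : {group {perm gT}}) : {set {set gT}} :=
  [set orbit 'P 'C_K[1%g | 'P] x | x : gT].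

(* V(K, G) *)
Definition transitivity_module (K : {group {perm gT}}) : zgring gT -> Prop :=
  zspan (stab1_orbits K).

Definition schurian (A : zgring gT -> Prop) : Prop :=
  exists K : {group {perm gT}},
    right_translations \subset K /\
    forall a, A a <-> transitivity_module K a.

End GroupRing.

Definition Schur_group (gT : finGroupType) : Prop :=
  forall A : zgring gT -> Prop, is_Sring A -> schurian A.

(* Main.v *)
From HB Require Import structures.
Require Import Defs.
From mathcomp Require Import all_boot all_order all_fingroup all_algebra.
From mathcomp Require Import all_solvable.
From mathcomp Require Import finfield ring zify.

(** If G is Schur then, for every S-ring over a subgroup of G, any two elements
    of a basic set are exchanged by an automorphism of the associated Cayley
    scheme that fixes 1: the group K with V(K, G) = A consists of automorphisms.
    So D_2n is not Schur as soon as some D_2m with m | n carries an S-ring having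
    a basic set on which these automorphisms are not transitive. Such S-rings are
    given for every minimal excluded m:
    - m = (ad)(bc) with coprime factors, a, b, c >= 3 and d >= 2: inversions on
      sections of orders a, b, c and d are forced to agree along b - c - a - d,
      while those on the sections of orders b and d are also independent;
    - m = 4p with p = 1 mod 4: fusion of an orbit S-ring along the conjugation of
      a quartic character of F_p, induced by no permutation of F_p;
    - m = 4p with p = 3 mod 4, p >= 7: the Paley difference set over D_2p glued
      to a Paley tournament over C_4p;
    - m = 24 and m = 36: two S-rings found by computer. *)

Set Implicit Arguments.
Unset Strict Implicit.
Unset Printing Implicit Defensive.

Import GRing.Theory.
Local Open Scope group_scope.
Local Open Scope ring_scope.

(** * S-rings as class functions *)

(** An S-ring is handled through a relation [R] that only generates its partition, so the axioms are
    checked on generating pairs alone. In the twisted and quartic cases no structure constant is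
    computed: two convolutions agree because of a bijection of the group that respects the classes.
    The maps supplied by schurity are not group automorphisms. All that is known is that they
    preserve the class of [h * g^-1], so they are followed point by point, with class functions as
    tests. The listed orders suffice for the following reason. In [(ad)(bc)] only [d] may be 2, so
    this case covers four primes, two odd primes both squared, and three primes one of which is odd
    and squared. Every other excluded [n] is a multiple of 4 with at least two prime divisors: a
    prime [p >= 5] gives a factor [4p], and among the [2^i 3^j] with [i >= 2], [j >= 1], all but 12
    are multiples of 24 or 36. *)

Lemma simple_quantityE (gT : finGroupType) (X : {set gT}) (g : gT) :
  simple_quantity X g = (g \in X)%:R.
Proof.
rewrite /simple_quantity sum_ffunE; under eq_bigr do rewrite zg_eltE.
case: (boolP (g \in X)) => gX; last first.
  by rewrite big1 // => x xX; case: eqP gX => // ->; rewrite xX.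
by rewrite (bigD1 g) //= eqxx big1 ?addr0 // => x /andP[_ /negPf]; rewrite eq_sym => ->.
Qed.

Lemma zg_mulrzE (gT : finGroupType) (a : zgring gT) (z : int) (g : gT) :
  (a *~ z) g = a g * z.
Proof.
have mulrnE n : (a *+ n) g = a g *+ n.
  by elim: n => [|n IHn]; rewrite ?mulr0n ?mulrS ffunE ?IHn.
by case: z => n; rewrite ?NegzE ?mulrNz -?pmulrn ?ffunE mulrnE ?mulrN -mulr_natr ?natz.
Qed.

Lemma zspanP (gT : finGroupType) (S : {set {set gT}}) (a : zgring gT) :
  partition S [set: gT] ->
  zspan S a <-> (forall X g h, X \in S -> g \in X -> h \in X -> a g = a h).
Proof.
case/and3P=> /eqP covS /trivIsetP tiS S0.
have sumE (c : {set gT} -> int) X g : X \in S -> g \in X ->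
    (\sum_(Y in S) simple_quantity Y *~ c Y) g = c X.
  move=> SX gX; rewrite sum_ffunE (bigD1 X) //= big1 ?addr0 => [|Y].
    by rewrite zg_mulrzE simple_quantityE gX mul1r.
  case/andP=> SY neYX; rewrite zg_mulrzE simple_quantityE.
  suff /negPf -> : g \notin Y by rewrite mul0r.
  by apply/negP=> gY; have /disjointFr/(_ gY) := tiS _ _ SY SX neYX; rewrite gX.
split=> [[c ->] X g h SX gX hX | cst]; first by rewrite !(sumE c X).
pose c (X : {set gT}) := if [pick g in X] is Some g then a g else 0.
exists c; apply/ffunP=> g.
have /bigcupP[X SX gX] : g \in cover S by rewrite covS inE.
rewrite (sumE c X g SX gX) /c; case: pickP => [h hX | /(_ g)]; last by rewrite gX.
exact: cst SX gX hX.
Qed.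

Section ClassFunctions.

Variables (gT : finGroupType) (R : rel gT).

Definition class_fun (V : Type) (f : gT -> V) := forall g h, R g h -> f g = f h.

(* R generates an S-ring: its basic sets are the connected components of R,
   which need not itself be an equivalence. *)
Definition Sring_rel :=
  [/\ forall g, R 1%g g || R g 1%g -> g = 1%g,
      forall f : gT -> int, class_fun f ->
        forall g h, R g h -> f g^-1%g = f h^-1%g
    & forall f1 f2 : gT -> int, class_fun f1 -> class_fun f2 -> forall g h, R g h ->
        \sum_k f1 k * f2 (g * k^-1)%g = \sum_k f1 k * f2 (h * k^-1)%g].

Let e := [rel g h | R g h || R h g].

Let e_sym : connect_sym e.
Proof. by apply: sym_connect_sym => g h; rewrite /= orbC. Qed.

Let class_connect V (f : gT -> V) : class_fun f ->
  forall g h, connect e g h -> f g = f h.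
Proof.
move=> fR g h /connectP[s]; elim: s g => [g _ -> //|k s IHs g /= /andP[gk ks] hE].
by rewrite -(IHs k ks hE); case/orP: gk => /fR.
Qed.

Let S := [set [set h | connect e g h] | g : gT].

Let S_equiv : S = equivalence_partition (connect e) [set: gT].
Proof.
rewrite /equivalence_partition /S; apply/setP=> X.
apply/imsetP/imsetP=> -[g _ ->]; exists g => //; apply/setP=> h; rewrite !inE //.
Qed.

Let S_partition : partition S [set: gT].
Proof.
rewrite S_equiv; apply: equivalence_partitionP => g h k _ _ _.
by split=> [|gh]; [exact: connect0 | exact: same_connect].
Qed.

Let S_spanP (a : zgring gT) : zspan S a <-> class_fun (a : gT -> int).
Proof.
split=> [/(zspanP _ S_partition) cst g h gh | aR].
  apply: (cst [set h | connect e g h]); rewrite ?inE ?connect0 //.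
    exact: imset_f.
  by apply: connect1; rewrite /= gh.
apply/(zspanP _ S_partition) => X g h.
case/imsetP=> k _ ->; rewrite !inE => kg kh.
by rewrite -(class_connect aR kg) (class_connect aR kh).
Qed.

Lemma Sring_rel_span : Sring_rel -> is_Sring (zspan S).
Proof.
(* The substitution [h = g * k^-1] brings the product of the group ring to a form in which only
   quotients [g * k^-1] occur, the invariants of right translations. *)
case=> R1 RV RM; have mulE (a b : zgring gT) g :
    (a * b) g = \sum_k b k * a (g * k^-1)%g.
  rewrite [LHS]zg_mulE (reindex_inj (inj_comp (mulgI g) invg_inj)) /=.
  by apply: eq_bigr => k _; rewrite invMg invgK mulgKV mulrC.
split.
  split=> [|a b /S_spanP aR /S_spanP bR|a b /S_spanP aR /S_spanP bR]; apply/S_spanP.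
  - move=> g h gh; rewrite [LHS]zg_eltE [RHS]zg_eltE; congr (_ %:R); congr nat_of_bool.
    by apply/eqP/eqP=> E; rewrite E in gh; apply: R1; rewrite gh ?orbT.
  - by move=> g h gh; rewrite !ffunE (aR g h) // (bR g h).
  by move=> g h gh; rewrite !mulE; apply: RM.
exists S; split=> //.
  apply/imsetP; exists 1%g => //; apply/setP=> g; rewrite !inE.
  apply/eqP/idP=> [->|]; first exact: connect0.
  case/connectP=> s; elim: s => [_ -> //|k s IHs /= /andP[k1 ks]].
  by move/R1: k1 ks => -> /IHs.
move=> X SX; have [k _ XE] := imsetP SX.
apply/imsetP; exists k^-1%g => //; apply/setP=> g; rewrite !inE.
have inv_class u v : connect e u v -> connect e u^-1%g v^-1%g.
  (* By the inversion axiom [x |-> f x^-1] is again a class function; it is 1 at [u], hence at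
     [v]. *)
  pose f (x : gT) : int := (connect e u^-1%g x)%:R.
  move=> uv; have fR : class_fun f.
    move=> x y xy; congr (_%:R); congr nat_of_bool; rewrite /f e_sym [RHS]e_sym.
    by apply: same_connect => //; apply: connect1; rewrite /= xy.
  have := class_connect (RV f fR) uv; rewrite /f connect0.
  by case: (connect e).
rewrite XE inE; apply/idP/idP=> /inv_class; rewrite ?invgK //.
Qed.

(** Testing indicator functions on both sides of [A = V(K, G)] shows that the components of [R] are
    the orbits of the stabilizer of 1 in [K]; [k] is an element of this stabilizer. *)
Lemma Schur_group_class_fun x x' : Schur_group gT -> Sring_rel -> R x x' ->
  exists k : gT -> gT,
    [/\ injective k, k 1%g = 1%g, k x = x'
      & forall (V : eqType) (f : gT -> V), class_fun f ->
          forall g h, f (k h * (k g)^-1)%g = f (h * g^-1)%g].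
Proof.
move=> schurG SR xx'; have [K [rK AK]] := schurG _ (Sring_rel_span SR).
have orbR g h : R g h -> h \in orbit 'P 'C_K[1%g | 'P] g.
  move=> gh; set X := orbit _ _ _.
  have /AK/S_spanP XR : transitivity_module K (simple_quantity X).
    exists (fun Y => (Y == X)%:R); rewrite (bigD1 X) ?imset_f //= eqxx mulr1z.
    by rewrite big1 ?addr0 // => Y /andP[_ /negPf ->].
  have := XR g h gh; rewrite !simple_quantityE orbit_refl.
  by case: (h \in X).
have Korb g h : h \in orbit 'P 'C_K[1%g | 'P] g -> connect e g h.
  move=> gh; set X := [set h | connect e g h].
  have SX : X \in S by exact: imset_f.
  have : zspan S (simple_quantity X).
    exists (fun Y => (Y == X)%:R); rewrite (bigD1 X) //= eqxx mulr1z.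
    by rewrite big1 ?addr0 // => Y /andP[_ /negPf ->].
  case/AK=> c; set Sum := (X in _ = X) => E.
  have sumE x0 : Sum x0 = \sum_(Y in stab1_orbits K) (x0 \in Y)%:R * c Y.
    rewrite /Sum sum_ffunE; apply: eq_bigr => Y _.
    by rewrite zg_mulrzE simple_quantityE.
  have : Sum g = Sum h.
    rewrite !sumE; apply: eq_bigr => Y /imsetP[y _ ->]; congr (_%:R * _).
    congr nat_of_bool; case/orbitP: gh => k kC <-.
    by rewrite orbit_actr.
  rewrite -E !simple_quantityE !inE connect0.
  by case: (connect e g h).
have /orbitP[k /setIP[kK /astab1P k1] kx] := orbR _ _ xx'.
exists k; split=> // [|V f fR g h]; first exact: perm_inj.
symmetry; apply: (class_connect fR); apply: Korb.
have rgK u : perm (mulIg u) \in K by apply: (subsetP rK); exact: imset_f.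
(* This is [x |-> k (x * g) * (k g)^-1]: it lies in [K], fixes 1 and carries [h * g^-1] to
   [k h * (k g)^-1]. *)
apply/orbitP; exists (perm (mulIg g) * k * perm (mulIg (k g)^-1))%g.
  apply/setIP; split; first by rewrite !groupM.
  by apply/astab1P; rewrite /= /aperm !permM !permE mul1g mulgV.
by rewrite /= /aperm !permM !permE mulgKV.
Qed.

End ClassFunctions.

(** * S-rings over a subgroup, extended to the whole group *)

Section Subgroup.

Variables (rT gT : finGroupType) (j : rT -> gT) (R : rel rT).
Hypotheses (jM : {morph j : u v / (u * v)%g}) (j_inj : injective j).

Let j1 : j 1%g = 1%g.
Proof. by apply: (mulgI (j 1%g)); rewrite -jM !mulg1. Qed.

Let jV u : j u^-1%g = (j u)^-1%g.
Proof. by apply: (mulgI (j u)); rewrite -jM !mulgV. Qed.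

Let H := [set j u | u : rT].

Let group_set_H : group_set H.
Proof.
apply/group_setP; split=> [|_ _ /imsetP[u _ ->] /imsetP[v _ ->]].
  by apply/imsetP; exists 1%g.
by rewrite -jM; apply: imset_f.
Qed.

Let GH : {group gT} := Group group_set_H.

Let R' : rel gT := fun g h => (g \notin GH) && (h \notin GH)
  || [exists u, exists v, [&& g == j u, h == j v & R u v]].

Let R'P g h : R' g h ->
  (g \notin GH /\ h \notin GH) \/ exists u v, [/\ g = j u, h = j v & R u v].
Proof.
case/orP=> [/andP[]|/existsP[u /existsP[v /and3P[/eqP gE /eqP hE uv]]]]; first by left.
by right; exists u, v.
Qed.

Let class_j V (f : gT -> V) : class_fun R' f -> class_fun R (f \o j).
Proof.
move=> fR u v uv; apply: fR; apply/orP; right; apply/existsP; exists u.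
by apply/existsP; exists v; rewrite !eqxx.
Qed.

Let class_notin V (f : gT -> V) g h : class_fun R' f ->
  g \notin GH -> h \notin GH -> f g = f h.
Proof. by move=> fR gH hH; apply: fR; rewrite /R' gH hH. Qed.

(* The S-ring over a subgroup H is extended to the whole group by the single
   class G \ H, so that the subgroup need not be normal. *)
Let Sring_rel_extension : Sring_rel R -> Sring_rel R'.
Proof.
case=> R1 RV RM; split.
- have jn1 u : (1%g == j u) = (u == 1%g) by rewrite -j1 (inj_eq j_inj) eq_sym.
  move=> g /orP[] /R'P[[]|[u [v [E1 E2 uv]]]]; rewrite ?group1 //.
    by rewrite E2 (R1 v) ?j1 //; move/eqP: E1; rewrite jn1 => /eqP <-; rewrite uv.
  by rewrite E1 (R1 u) ?j1 //; move/eqP: E2; rewrite jn1 => /eqP <-; rewrite uv orbT.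
- move=> f fR g h /R'P[[gH hH]|[u [v [-> -> uv]]]].
    by apply: class_notin => //; rewrite groupV.
  rewrite -!jV; exact: RV (class_j fR) _ _ uv.
move=> f1 f2 f1R f2R g h /R'P[[gH hH]|[u [v [-> -> uv]]]]; last first.
  rewrite (bigID (mem GH)) [RHS](bigID (mem GH)) /=; congr (_ + _); last first.
    apply: eq_bigr => k kH; congr (_ * _); apply: class_notin => //;
    by rewrite groupMl ?groupV ?imset_f.
  rewrite !big_imset /=; try by move=> ? ? _ _ /j_inj.
  have := RM _ _ (class_j f1R) (class_j f2R) u v uv.
  rewrite (eq_bigr (fun k => f1 (j k) * f2 (j u * (j k)^-1)%g)) => [|k _].
    move=> ->; apply: eq_bigr => k _ /=; by rewrite jM jV.
  by rewrite /= jM jV.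
(* For [k] in the subgroup the second factor is constant, for the other [k] the first one is; the
   value obtained does not mention [x]. *)
have sumE x : x \notin GH -> \sum_k f1 k * f2 (x * k^-1)%g =
    \sum_(k in GH) f1 k * f2 g + f1 g * (\sum_k f2 k - \sum_(k in GH) f2 g).
  move=> xH; have xkH k : k \in GH -> f2 (x * k^-1)%g = f2 g.
    by move=> kH; apply: class_notin => //; rewrite groupMr ?groupV.
  rewrite (bigID (mem GH)) /=; congr (_ + _).
    by apply: eq_bigr => k kH; rewrite xkH.
  have -> : \sum_k f2 k = \sum_k f2 (x * k^-1)%g.
    exact: (reindex_inj (inj_comp (mulgI x) invg_inj)).
  rewrite [X in _ = _ * (X - _)](bigID (mem GH)) /=.
  have -> : \sum_(k in GH) f2 (x * k^-1)%g = \sum_(k in GH) f2 g.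
    by apply: eq_bigr => k kH; rewrite xkH.
  rewrite [X in _ = _ * X]addrC addKr mulr_sumr.
  by apply: eq_bigr => k kH; rewrite (class_notin f1R kH gH).
by rewrite !sumE.
Qed.

Lemma Schur_subgroup_class_fun x x' : Schur_group gT -> Sring_rel R -> R x x' ->
  exists k : rT -> rT,
    [/\ injective k, k 1%g = 1%g, k x = x'
      & forall (V : eqType) (f : rT -> V), class_fun R f ->
          forall g h, f (k h * (k g)^-1)%g = f (h * g^-1)%g].
Proof.
move=> schurG /Sring_rel_extension SR' xx'.
have R'xx' : R' (j x) (j x').
  by apply/orP; right; apply/existsP; exists x; apply/existsP; exists x'; rewrite !eqxx.
have [k [k_inj k1 kx kP]] := Schur_group_class_fun schurG SR' R'xx'.
have kH u : exists v, k (j u) = j v.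
  have HR : class_fun R' (mem GH : gT -> bool).
    move=> g h /R'P[[/negPf gH /negPf hH]|[v [w [-> -> _]]]].
      by rewrite /= gH hH.
    by rewrite /= !imset_f.
  have := kP _ _ HR 1%g (j u); rewrite k1 invg1 !mulg1 /= => kuH.
  by have /imsetP[v _ ->] : k (j u) \in GH by [rewrite kuH imset_f]; exists v.
pose k' u := odflt 1%g [pick v | j v == k (j u)].
have jk u : j (k' u) = k (j u).
  rewrite /k'; case: pickP => [v /eqP //|]; have [v ->] := kH u.
  by move/(_ v); rewrite eqxx.
exists k'; split.
- by move=> u v /(congr1 j); rewrite !jk => /k_inj/j_inj.
- by apply: j_inj; rewrite jk !j1 k1.
- by apply: j_inj; rewrite jk.
(* Extending [f] by [None] yields a class function of [R'] for any [V], without a default value. *)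
move=> V f fR g h; pose F x : option V := omap f [pick v | j v == x].
have Fj u : F (j u) = Some (f u).
  rewrite /F; case: pickP => [v /eqP/j_inj -> //|/(_ u)]; by rewrite eqxx.
have FR : class_fun R' F.
  move=> y z /R'P[[yH zH]|[u [v [-> -> /fR uv]]]]; last by rewrite !Fj uv.
  rewrite /F; case: pickP => [v /eqP yE|_]; first by rewrite -yE imset_f in yH.
  by case: pickP => [v /eqP zE|_] //; rewrite -zE imset_f in zH.
have := kP _ _ FR (j g) (j h).
by rewrite -!jk -!jV -!jM !Fj => -[].
Qed.

End Subgroup.

(** * Generalized dihedral groups *)

HB.instance Definition _ (U V : finZmodType) := GRing.Zmodule.on (U * V)%type.

Section Dihedral.

Variable A : finZmodType.

(* The generalized dihedral group of A: (a, e) stands for a y^e, where the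
   involution y inverts A. *)
Definition dih : Type := (A * bool)%type.

HB.instance Definition _ := Finite.on dih.

Definition dih_mul (g h : dih) : dih :=
  (g.1 + (if g.2 then - h.1 else h.1), g.2 (+) h.2).
Definition dih_inv (g : dih) : dih := (if g.2 then g.1 else - g.1, g.2).

Fact dih_mulA : associative dih_mul.
Proof.
move=> [a e] [b f] [c k]; rewrite /dih_mul /= addbA; congr (_, _).
by case: e f => -[]; rewrite /= ?opprD ?opprK addrA.
Qed.

Fact dih_mul1 : left_id ((0, false) : dih) dih_mul.
Proof. by case=> a e; rewrite /dih_mul /= add0r. Qed.

Fact dih_mulV : left_inverse ((0, false) : dih) dih_inv dih_mul.
Proof. by move=> [a []]; rewrite /dih_mul /dih_inv /= ?subrr ?addNr. Qed.

HB.instance Definition _ := Finite_isGroup.Build dih dih_mulA dih_mul1 dih_mulV.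

Lemma dihM (a b : A) (e f : bool) :
  (((a, e) : dih) * ((b, f) : dih))%g = (a + (if e then - b else b), e (+) f).
Proof. by []. Qed.

Lemma dihV (a : A) (e : bool) :
  ((a, e) : dih)^-1%g = (if e then a else - a, e).
Proof. by []. Qed.

Lemma dihJ (a b : A) (e : bool) :
  (((a, false) : dih) ^ ((b, e) : dih))%g = (if e then - a else a, false).
Proof.
rewrite conjgE dihV !dihM; case: e => /=; rewrite ?addbb; congr (_, _).
  by rewrite opprD addrC addrNK.
by rewrite addrC addrK.
Qed.

End Dihedral.

(** * Dihedral groups *)

(** If [y] were a power of [x], the group of order [2 * n] would be generated by [x], whose order is
    at most [n]. Hence [<[x]>] has index 2, which gives the exact order of [x]. *)
Lemma dihedral_generators n : (1 < n)%N ->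
  exists x y : 'D_(2 * n), [/\ #[x] = n, y \notin <[x]>, (y * y = 1)%g & (x ^ y = x^-1)%g].
Proof.
move=> n_gt1; rewrite mul2n.
case/(isoGrpP _ (Grp_dihedral n_gt1)): (isog_refl [set: 'D_(n.*2)]).
have oG := card_dihedral n_gt1; move=> _ /existsP[[x y] /= /eqP[defG xn y2 xy]].
have {}defG : (<[x]> * <[y]>)%g = [set: 'D_(n.*2)].
  by rewrite -norm_joinEr // norms_cycle xy groupV cycle_id.
have ox_le : (#[x] <= n)%N by rewrite dvdn_leq ?order_dvdn ?xn // ltnW.
have notXy : y \notin <[x]>.
  apply/negP=> Xy; have := ox_le; rewrite orderE -(mulGSid (_ : <[y]> \subset <[x]>)).
    by rewrite defG oG leqNgt -addnn -addn1 leq_add2l ltnW.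
  by rewrite cycle_subG.
have oy : #[y] = 2 by apply: nt_prime_order (group1_contra notXy).
exists x, y; split=> //; apply: double_inj; apply: etrans oG; rewrite -defG TI_cardMg -?orderE ?oy ?muln2 //.
by rewrite setIC prime_TIg ?cycle_subG // -orderE oy.
Qed.

Lemma expg_Zp_add (gT : finGroupType) (x : gT) r (u v : 'Z_r) :
  (1 < r)%N -> (x ^+ r = 1)%g -> (x ^+ (u + v)%R = x ^+ u * x ^+ v)%g.
Proof.
move=> r_gt1 xr; rewrite -expgD -(expg_mod (u + v) xr); congr (x ^+ _)%g.
by rewrite /=; congr (_ %% _)%N; apply: Zp_cast.
Qed.

Lemma expg_Zp_opp (gT : finGroupType) (x : gT) r (u : 'Z_r) :
  (1 < r)%N -> (x ^+ r = 1)%g -> (x ^+ (- u)%R = (x ^+ u)^-1)%g.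
Proof.
move=> r_gt1 xr; apply: (mulIg (x ^+ u)%g).
by rewrite -expg_Zp_add // addNr expg0 mulVg.
Qed.

(** Every S-ring below is defined by coordinates on two coprime parts of the cyclic subgroup. These
    parts are generated by powers of [x] of orders [r] and [s], and coprimality makes them meet
    trivially. *)
Lemma dih_embedding n r s : (1 < n)%N -> (1 < r)%N -> (1 < s)%N ->
  coprime r s -> (r * s %| n)%N ->
  exists j : dih ('Z_r * 'Z_s)%type -> 'D_(2 * n),
    {morph j : g h / (g * h)%g} /\ injective j.
Proof.
move=> n_gt1 r_gt1 s_gt1 co_rs rs_n.
have [x [y [ox yx y2 xy]]] := dihedral_generators n_gt1.
have r_n : (r %| n)%N by apply: dvdn_trans rs_n; apply: dvdn_mulr.
have s_n : (s %| n)%N by apply: dvdn_trans rs_n; apply: dvdn_mull.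
pose x1 := (x ^+ (n %/ r))%g; pose x2 := (x ^+ (n %/ s))%g.
have order_part t : (t %| n)%N -> #[(x ^+ (n %/ t))%g] = t.
  move=> t_n; rewrite orderXdiv ox ?dvdn_div // divnA // ?mulKn //.
  by rewrite ltnW.
have x1r : (x1 ^+ r = 1)%g by rewrite -(order_part r r_n) expg_order.
have x2s : (x2 ^+ s = 1)%g by rewrite -(order_part s s_n) expg_order.
pose w (a : 'Z_r * 'Z_s) : 'D_(2 * n) := (x1 ^+ a.1 * x2 ^+ a.2)%g.
have x12 i k : commute (x1 ^+ i)%g (x2 ^+ k)%g.
  by rewrite /commute -!expgM -!expgD addnC.
have wD a b : w (a + b) = (w a * w b)%g.
  rewrite /w !expg_Zp_add //= -!mulgA; congr (_ * _)%g.
  by rewrite !mulgA (x12 b.1 a.2).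
have w0 : w 0 = 1%g by rewrite /w !expg0 mulg1.
have wN a : w (- a) = (w a)^-1%g.
  by apply: (mulIg (w a)); rewrite -wD addNr w0 mulVg.
have wx a : w a \in <[x]> by rewrite groupM ?groupX // ?cycle_id.
have wy a : (y * w a = w (- a) * y)%g.
  have yV : y^-1%g = y by apply: (mulgI y); rewrite mulgV y2.
  rewrite wN; have /cycleP[i ->] := wx a.
  have <- : ((x ^+ i) ^ y = (x ^+ i)^-1)%g by rewrite conjXg xy expVgn.
  by rewrite conjgE yV -!mulgA y2 mulg1.
have w_inj : injective w.
  move=> a b /eqP; rewrite eq_mulgV1 -wN -wD => /eqP wab; apply/eqP.
  rewrite -subr_eq0; move: (a - b) wab => c {a b} wc.
  have E : (x1 ^+ c.1 = x2 ^+ (- c.2))%g.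
    rewrite expg_Zp_opp //; apply/eqP; rewrite eq_mulgV1 invgK; exact/eqP.
  have tr : (<[x1]> :&: <[x2]> = 1)%g.
    by apply: coprime_TIg; rewrite -!orderE !order_part.
  have c1 : (x1 ^+ c.1 = 1)%g.
    by apply/set1gP; rewrite -tr inE mem_cycle E mem_cycle.
  have c2 : (x2 ^+ c.2 = 1)%g by move: wc; rewrite /w c1 mul1g.
  have expg_eq1 t (z : 'D_(2 * n)) (u : 'Z_t) : (1 < t)%N -> #[z] = t -> (z ^+ u = 1)%g -> u = 0.
    move=> t_gt1 oz /eqP; rewrite -order_dvdn oz => tu; apply/val_inj => /=.
    have ut : (u < t)%N by have := ltn_ord u; rewrite [X in (_ < X)%N]Zp_cast.
    by apply/eqP; rewrite -(modn_small ut).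
  case: c {E wc} c1 c2 => c1 c2 /= c1E c2E.
  rewrite (expg_eq1 r x1 c1 r_gt1 (order_part r r_n) c1E).
  by rewrite (expg_eq1 s x2 c2 s_gt1 (order_part s s_n) c2E).
clearbody w; exists (fun g => w g.1 * (if g.2 then y else 1))%g; split.
  move=> [a e] [b f]; rewrite dihM /= wD -!mulgA; congr (_ * _)%g.
  case: e => /=; last by rewrite mul1g.
  rewrite mulgA wy -mulgA; congr (_ * _)%g.
  by case: f; rewrite /= ?y2 ?mulg1.
move=> [a e] [b f] /=.
have ney c d : w c != (w d * y)%g.
  apply: contra yx => /eqP E.
  by rewrite -(mulKg (w d) y) -E groupM ?groupV.
case: e f => -[]; rewrite ?mulg1 => E.
- by rewrite (w_inj _ _ (mulIg _ _ _ E)).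
- by case/eqP: (ney b a).
- by case/eqP: (ney a b).
- by rewrite (w_inj _ _ E).
Qed.

Lemma Schur_dihedral_class_fun n r s (R : rel (dih ('Z_r * 'Z_s)%type)) x x' :
  Schur_group ('D_(2 * n))%type -> (1 < n)%N -> (1 < r)%N -> (1 < s)%N ->
  coprime r s -> (r * s %| n)%N -> Sring_rel R -> R x x' ->
  exists k : dih ('Z_r * 'Z_s)%type -> dih ('Z_r * 'Z_s)%type,
    [/\ injective k, k 1%g = 1%g, k x = x'
      & forall (V : eqType) (f : dih ('Z_r * 'Z_s)%type -> V), class_fun R f ->
          forall g h, f (k h * (k g)^-1)%g = f (h * g^-1)%g].
Proof.
move=> schurD n_gt1 r_gt1 s_gt1 co_rs rs_n.
have [j [jM j_inj]] := dih_embedding n_gt1 r_gt1 s_gt1 co_rs rs_n.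
exact: (Schur_subgroup_class_fun jM j_inj schurD).
Qed.

(** * The twisted S-ring *)

(** Tool for the third axiom: [phi] has to preserve the class of [k] and to match that of [g * k^-1]
    with that of [h * (phi k)^-1]. *)
Lemma eq_conv (gT : finGroupType) (f1 f2 : gT -> int) (g h : gT) (phi : gT -> gT) :
  injective phi -> (forall k, f1 (phi k) = f1 k) ->
  (forall k, f2 (h * (phi k)^-1)%g = f2 (g * k^-1)%g) ->
  \sum_k f1 k * f2 (g * k^-1)%g = \sum_k f1 k * f2 (h * k^-1)%g.
Proof.
move=> phi_inj f1phi f2phi; rewrite [RHS](reindex_inj phi_inj).
by apply: eq_bigr => k _; rewrite f1phi f2phi.
Qed.

Section TwistedProduct.

Variables (gT : finGroupType) (U M A C : {group gT}) (th th1 : gT -> gT).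
Hypotheses (thM : {morph th : g h / (g * h)%g}) (thK : involutive th).
Hypotheses (th1M : {morph th1 : g h / (g * h)%g}) (th1K : involutive th1).
Hypotheses (nA : forall g, g \in 'N(A)) (nC : forall g, g \in 'N(C)).
Hypotheses (sAU : A \subset U) (sAM : A \subset M).
Hypotheses (sCU : C \subset U) (sCM : C \subset M).
Hypothesis (UM_AC : forall g, g \in U -> g \in M -> g \in (A * C)%g).
Hypothesis th1_U : forall g, (th1 g \in U) = (g \in U).
Hypothesis th1_M : forall g, (th1 g \in M) = (g \in M).
Hypothesis th_M : forall g, (th g \in M) = (g \in M).
Hypothesis th1_modA : forall g, g \in U -> (g^-1 * th1 g)%g \in A.
Hypothesis th1_modC : forall g, g \in M -> ((th g)^-1 * th1 g)%g \in C.
Hypothesis th_U : forall g, (th g \in U) = (g \in U).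

(* The classes are {g, th g} on AC = U :&: M, {g, th g}A on U, {g, th g}C on M,
   and {g, th g, th1 g, th (th1 g)}AC outside U and M. *)
Definition twisted_rel : rel gT := fun g h =>
  [|| h == th g, (g \notin M) && ((g^-1 * h)%g \in A),
      (g \notin U) && ((g^-1 * h)%g \in C)
    | [&& g \notin U, g \notin M & h == th1 g]].

Section TwistedClassFun.

Variables (V : Type) (f : gT -> V).
Hypothesis fR : class_fun twisted_rel f.

Lemma twisted_th g : f (th g) = f g.
Proof. by apply/esym/fR; rewrite /twisted_rel eqxx. Qed.

Lemma twisted_mulA g a : g \notin M -> a \in A -> f (g * a)%g = f g.
Proof.
by move=> gM aA; apply/esym/fR; rewrite /twisted_rel mulKg gM aA orbT.
Qed.

Lemma twisted_mulC g c : g \notin U -> c \in C -> f (g * c)%g = f g.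
Proof.
by move=> gU cC; apply/esym/fR; rewrite /twisted_rel mulKg gU cC !orbT.
Qed.

Lemma twisted_mulN g n : g \notin U -> g \notin M -> n \in U :&: M ->
  f (g * n)%g = f g.
Proof.
move=> gU gM /setIP[nU nM]; have /mulsgP[a c aA cC ->] := UM_AC nU nM.
rewrite mulgA twisted_mulC ?twisted_mulA //.
by rewrite groupMr // (subsetP sAU).
Qed.

Lemma twisted_mulNl g n : g \notin U -> g \notin M -> n \in U :&: M ->
  f (n * g)%g = f g.
Proof.
move=> gU gM /setIP[nU nM]; have /mulsgP[a c aA cC ->] := UM_AC nU nM.
have agA : (a ^ g)%g \in A by rewrite memJ_norm.
have cgC : (c ^ g)%g \in C by rewrite memJ_norm.
rewrite conjgC twisted_mulN // conjMg; apply/setIP; split; apply: groupM.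
- exact: (subsetP sAU).
- exact: (subsetP sCU).
- exact: (subsetP sAM).
- exact: (subsetP sCM).
Qed.

(** One hypothesis serves each region: on [U], [th1 g] stays in [gA]; on [M], it stays in the coset
    [th(g)C]; outside both, [th1] is a generator of the relation. Only on [U :&: M] may [th1] change
    the class. *)
Lemma twisted_th1 g : g \notin U :&: M -> f (th1 g) = f g.
Proof.
rewrite inE negb_and; have [gU /= gM|gU _] := boolP (g \in U).
  by rewrite -[th1 g](mulKVg g) twisted_mulA ?th1_modA.
have [gM|gM] := boolP (g \in M); last first.
  by apply/esym/fR; rewrite /twisted_rel gU gM eqxx !orbT.
rewrite -[th1 g](mulKVg (th g)) twisted_mulC ?th1_modC ?twisted_th //.
by rewrite th_U.
Qed.

End TwistedClassFun.

Let th11 : th1 1%g = 1%g.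
Proof. by apply: (mulgI (th1 1%g)); rewrite -th1M !mulg1. Qed.

Let th_1 : th 1%g = 1%g.
Proof. by apply: (mulgI (th 1%g)); rewrite -thM !mulg1. Qed.

Let th1V g : th1 g^-1%g = (th1 g)^-1%g.
Proof. by apply: (mulgI (th1 g)); rewrite -th1M !mulgV th11. Qed.

Let thV g : th g^-1%g = (th g)^-1%g.
Proof. by apply: (mulgI (th g)); rewrite -thM !mulgV th_1. Qed.

Lemma twisted_relV V (f : gT -> V) : class_fun twisted_rel f ->
  forall g h, twisted_rel g h -> f g^-1%g = f h^-1%g.
Proof.
have decomp (g h : gT) : h^-1%g = (g^-1 * ((g^-1 * h)^-1 ^ g^-1))%g.
  by rewrite conjgE invgK invMg invgK !mulgA mulVg mul1g mulgK.
move=> fR g h /or4P[/eqP -> | /andP[gM ghA] | /andP[gU ghC] | /and3P[gU gM /eqP ->]].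
- by rewrite -thV twisted_th.
- by rewrite (decomp g h) twisted_mulA ?memJ_norm ?groupV.
- by rewrite (decomp g h) twisted_mulC ?memJ_norm ?groupV.
- by rewrite -th1V twisted_th1 // inE negb_and groupV gU.
Qed.

(** Right multiplication by [b] is applied exactly on the coset [Xg]. There [g * k^-1] does not
    change and [k] is outside [X]; elsewhere [k] does not change and [g * k^-1] is outside [X],
    where [f2] absorbs a conjugate of [b]. *)
Let conv_shift (X B : {group gT}) (f1 f2 : gT -> int) g b :
  (forall k, k \in 'N(B)) -> B \subset X -> b \in B -> g \notin X ->
  (forall k c, k \notin X -> c \in B -> f1 (k * c)%g = f1 k) ->
  (forall k c, k \notin X -> c \in B -> f2 (k * c)%g = f2 k) ->
  \sum_k f1 k * f2 (g * k^-1)%g = \sum_k f1 k * f2 (g * b * k^-1)%g.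
Proof.
move=> nB sBX bB gX f1B f2B.
pose phi k := if (k * g^-1)%g \in X then (k * b)%g else k.
have gbX : (g * b * g^-1)%g \in X.
  have -> : (g * b * g^-1 = b ^ g^-1)%g by rewrite conjgE invgK mulgA.
  by rewrite (subsetP sBX) // memJ_norm.
have phiX k : ((phi k * g^-1)%g \in X) = ((k * g^-1)%g \in X).
  rewrite /phi; case: ifP => // kX.
  have -> : (k * b * g^-1 = (k * g^-1) * (g * b * g^-1))%g.
    by rewrite !mulgA mulgKV.
  by rewrite groupM.
apply: (eq_conv (phi := phi)) => [k k' E|k|k].
- have kX : ((k * g^-1)%g \in X) = ((k' * g^-1)%g \in X) by rewrite -phiX E phiX.
  by move: E; rewrite /phi kX; case: ifP => // _ /mulIg.
- rewrite /phi; case: ifP => // kX; apply: f1B => //.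
  by apply: contra gX => kX'; rewrite -groupV -(groupMl _ kX').
rewrite /phi; case: ifP => kX; first by rewrite invMg mulgA mulgK.
rewrite -[RHS](f2B _ (b ^ k^-1)%g) ?memJ_norm //; last first.
  by rewrite -groupV invMg invgK kX.
by rewrite conjgE invgK !mulgA mulgKV.
Qed.

Lemma twisted_rel_Sring : Sring_rel twisted_rel.
Proof.
split.
- move=> g /orP[] /or4P[/eqP E | /andP[gM gA] | /andP[gU gC] | /and3P[gU gM /eqP E]].
  + by rewrite E th_1.
  + by rewrite group1 in gM.
  + by rewrite group1 in gU.
  + by rewrite group1 in gU.
  + by rewrite -(thK g) -E th_1.
  + by rewrite mulg1 groupV in gA; rewrite (subsetP sAM) in gM.
  + by rewrite mulg1 groupV in gC; rewrite (subsetP sCU) in gU.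
  + by rewrite -th1_U -E group1 in gU.
- by move=> f fR g h; apply: twisted_relV.
move=> f1 f2 f1R f2R g h /or4P[/eqP -> | /andP[gM ghA] | /andP[gU ghC] | /and3P[gU gM /eqP ->]].
- apply: (eq_conv (phi := th)) => [|k|k]; first exact: inv_inj.
    exact: twisted_th.
  by rewrite -thV -thM twisted_th.
- rewrite -(mulKVg g h); apply: (conv_shift (X := M) (B := A)) => // k c kM cA;
  exact: twisted_mulA.
- rewrite -(mulKVg g h); apply: (conv_shift (X := U) (B := C)) => // k c kM cA;
  exact: twisted_mulC.
pose N := (U :&: M)%G.
have th1_N k : (th1 k \in N) = (k \in N) by rewrite !inE th1_U th1_M.
have gN : g \notin N by rewrite inE negb_and gU.
(* [th1] would do, except where [k] or [g * k^-1] lies in [N], since it may change classes there.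
   These elements are kept instead: [k] itself in the first case, the quotient in the second; the
   other factor lies in a class invariant under [N]. *)
pose phi k := if k \in N then k else
  if (k * g^-1)%g \in N then (k * g^-1 * th1 g)%g else th1 k.
have NgN k : (k * g^-1)%g \in N -> k \notin N.
  by move=> kgN; apply: contra gN => kN; rewrite -groupV -(groupMl _ kN).
have Ng'N k : (k * g^-1)%g \in N -> (k * g^-1 * th1 g)%g \notin N.
  by move=> kgN; rewrite groupMl // th1_N.
apply: (eq_conv (phi := phi)) => [k k'|k|k].
- have phiN y : (phi y \in N) = (y \in N).
    rewrite /phi; case: ifP => // yN; case: ifP => ygN; last by rewrite th1_N.
    by apply/negbTE/Ng'N.
  have phiNg y : ((phi y * (th1 g)^-1)%g \in N) = ((y * g^-1)%g \in N).
    rewrite /phi; have [yN|yN] := boolP (y \in N).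
      by rewrite !groupMl // !groupV th1_N.
    case: ifP => ygN; first by rewrite mulgK.
    by rewrite -th1V -th1M th1_N.
  move=> E; have kN : (k \in N) = (k' \in N) by rewrite -phiN E phiN.
  have kNg : ((k * g^-1)%g \in N) = ((k' * g^-1)%g \in N).
    by rewrite -phiNg E phiNg.
  move: E; rewrite /phi kN kNg; case: ifP => // _; case: ifP => _.
    by move/mulIg/mulIg.
  exact: inv_inj.
- rewrite /phi; case: ifP => // kN; case: ifP => kgN; last first.
    by rewrite twisted_th1 // kN.
  rewrite (twisted_mulNl f1R) ?th1_U ?th1_M // (twisted_th1 f1R gN).
  by rewrite -[in RHS](mulgKV g k) (twisted_mulNl f1R).
rewrite /phi; case: ifP => [kN|_].
  by rewrite !(twisted_mulN f2R) ?th1_U ?th1_M ?groupV // (twisted_th1 f2R gN).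
case: ifP => [_|kgN]; first by rewrite !invMg !invgK mulgA mulgV mul1g.
by rewrite -th1V -th1M (twisted_th1 f2R) // -groupV invMg invgK kgN.
Qed.

(** This and the next two results supply the test functions on [U], [M] and [U :&: M] by which an
    automorphism will be followed. *)
Lemma twisted_class_funU (V : Type) (F : gT -> V) :
  (forall g, F (th g) = F g) -> (forall g a, a \in A -> F (g * a)%g = F g) ->
  class_fun twisted_rel (fun g => if g \in U then Some (F g) else None).
Proof.
move=> Fth FA g h /or4P[/eqP -> | /andP[gM ghA] | /andP[gU ghC] | /and3P[gU gM /eqP ->]].
- by rewrite th_U Fth.
- rewrite -(mulKVg g h) groupMr ?FA //; exact: (subsetP sAU).
- rewrite -(mulKVg g h) groupMr ?(negPf gU) //; exact: (subsetP sCU).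
- by rewrite th1_U (negPf gU).
Qed.

Lemma twisted_class_funM (V : Type) (F : gT -> V) :
  (forall g, F (th g) = F g) -> (forall g c, c \in C -> F (g * c)%g = F g) ->
  class_fun twisted_rel (fun g => if g \in M then Some (F g) else None).
Proof.
move=> Fth FC g h /or4P[/eqP -> | /andP[gM ghA] | /andP[gU ghC] | /and3P[gU gM /eqP ->]].
- by rewrite th_M Fth.
- rewrite -(mulKVg g h) groupMr ?(negPf gM) //; exact: (subsetP sAM).
- rewrite -(mulKVg g h) groupMr ?FC //; exact: (subsetP sCM).
- by rewrite th1_M (negPf gM).
Qed.

Lemma twisted_class_funN (V : Type) (F : gT -> V) : (forall g, F (th g) = F g) ->
  class_fun twisted_rel
    (fun g => if (g \in U) && (g \in M) then Some (F g) else None).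
Proof.
move=> Fth g h /or4P[/eqP -> | /andP[gM ghA] | /andP[gU ghC] | /and3P[gU gM /eqP ->]].
- by rewrite th_U th_M Fth.
- rewrite -(mulKVg g h) (negPf gM) [_ \in M]groupMr ?(negPf gM) ?andbF //; exact: (subsetP sAM).
- rewrite -(mulKVg g h) (negPf gU) groupMr ?(negPf gU) //; exact: (subsetP sCU).
- by rewrite th1_U (negPf gU).
Qed.

End TwistedProduct.

Section ZpDivisibility.

#[local] Arguments nat_of_ord : simpl never.

Variables (d r : nat).
Hypotheses (r_gt1 : (1 < r)%N) (dr : (d %| r)%N).

Lemma dvdn_ZpD (u v : 'Z_r) : (d %| u)%N -> (d %| (u + v)%R)%N = (d %| v)%N.
Proof.
have dr' : (d %| (Zp_trunc r).+2)%N by rewrite Zp_cast.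
by move=> du; rewrite /= /dvdn modn_dvdm // -/(dvdn _ _) dvdn_addr.
Qed.

Lemma dvdn_ZpN (u : 'Z_r) : (d %| (- u)%R)%N = (d %| u)%N.
Proof.
suff imp v : (d %| (v : 'Z_r))%N -> (d %| (- v)%R)%N.
  by apply/idP/idP=> /imp //; rewrite opprK.
by move=> dv; rewrite -(dvdn_ZpD (u := v)) // subrr dvdn0.
Qed.

Lemma dvdn_Zp_nat k : (d %| (k%:R : 'Z_r)%R)%N = (d %| k)%N.
Proof. by rewrite val_Zp_nat // /dvdn modn_dvdm. Qed.

End ZpDivisibility.

Lemma Zp_neq_opp r k : (1 < r)%N -> ~~ (r %| k.*2)%N ->
  (k%:R : 'Z_r) != - k%:R.
Proof.
move=> r_gt1; apply: contra; rewrite -subr_eq0 opprK -natrD addnn => /eqP k2.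
by rewrite -(dvdn_Zp_nat r_gt1) // k2 dvdn0.
Qed.

(** * The twisted S-ring over a dihedral group *)

Section TwistedDihedral.

#[local] Arguments nat_of_ord : simpl never.

Variables (a b c d : nat).
Hypotheses (a_gt2 : (2 < a)%N) (b_gt2 : (2 < b)%N) (c_gt2 : (2 < c)%N).
Hypothesis d_gt1 : (1 < d)%N.

Local Notation r := (a * d)%N.
Local Notation s := (b * c)%N.
Local Notation gT := (dih ('Z_r * 'Z_s)%type).

Let r_gt1 : (1 < r)%N.
Proof. by rewrite (leq_trans d_gt1) // leq_pmull // (ltn_trans _ a_gt2). Qed.

Let s_gt1 : (1 < s)%N.
Proof. by rewrite (leq_trans (ltnW b_gt2)) // leq_pmulr // (ltn_trans _ c_gt2). Qed.

Let dr : (d %| r)%N. Proof. exact: dvdn_mull. Qed.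
Let bs : (b %| s)%N. Proof. exact: dvdn_mulr. Qed.

(** This automorphism inverts [x1], fixes [x2] and sends [y] to [x1^-1 y]; [tw_th] inverts [x2] as
    well. The shift on reflections makes the action visible on the section of order [d], where 0 and
    -1 differ. *)
Definition tw_th1 (g : gT) : gT := ((- g.1.1 - g.2%:R, g.1.2), g.2).
Definition tw_th (g : gT) : gT := ((- g.1.1 - g.2%:R, - g.1.2), g.2).

Lemma tw_th1M : {morph tw_th1 : g h / (g * h)%g}.
Proof.
move=> [[u v] e] [[u' v'] e']; rewrite !dihM /tw_th1 /=; congr (_, _, _).
  by case: e e' => -[] /=; ring.
by case: e.
Qed.

Lemma tw_thM : {morph tw_th : g h / (g * h)%g}.
Proof.
move=> [[u v] e] [[u' v'] e']; rewrite !dihM /tw_th /=; congr (_, _, _).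
  by case: e e' => -[] /=; ring.
by case: e => /=; ring.
Qed.

Lemma tw_th1K : involutive tw_th1.
Proof. by move=> [[u v] e]; rewrite /tw_th1 /=; congr (_, _, _); ring. Qed.

Lemma tw_thK : involutive tw_th.
Proof. by move=> [[u v] e]; rewrite /tw_th /=; congr (_, _, _); ring. Qed.

(** [A] and [C] are the subgroups of orders [a] and [c] in the two cyclic factors; [U] is [A] times
    the second factor and [M] the dihedral group over the first factor times [C]. *)
Definition tw_U := [set g : gT | ~~ g.2 && (d %| g.1.1)%N].
Definition tw_M := [set g : gT | (b %| g.1.2)%N].
Definition tw_A := [set g : gT | [&& ~~ g.2, (d %| g.1.1)%N & g.1.2 == 0]].
Definition tw_C := [set g : gT | [&& ~~ g.2, g.1.1 == 0 & (b %| g.1.2)%N]].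

Fact tw_U_group : group_set tw_U.
Proof.
apply/group_setP; split=> [|[[u v] e] [[u' v'] e']]; rewrite !inE ?dvdn0 //=.
by case: e e' => -[] //= du; rewrite (dvdn_ZpD r_gt1).
Qed.

Fact tw_M_group : group_set tw_M.
Proof.
apply/group_setP; split=> [|[[u v] e] [[u' v'] e']]; rewrite !inE ?dvdn0 //= => bv bv'.
by rewrite (dvdn_ZpD s_gt1) //; case: e; rewrite /= ?(dvdn_ZpN s_gt1).
Qed.

Fact tw_A_group : group_set tw_A.
Proof.
apply/group_setP; split=> [|[[u v] e] [[u' v'] e']]; rewrite !inE ?dvdn0 ?eqxx //=.
case: e e' => -[] //= /andP[du /eqP->] /andP[du' /eqP->].
by rewrite (dvdn_ZpD r_gt1) // du' addr0 eqxx.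
Qed.

Fact tw_C_group : group_set tw_C.
Proof.
apply/group_setP; split=> [|[[u v] e] [[u' v'] e']]; rewrite !inE ?dvdn0 ?eqxx //=.
case: e e' => -[] //= /andP[/eqP-> bv] /andP[/eqP-> bv'].
by rewrite (dvdn_ZpD s_gt1) // bv' addr0 eqxx.
Qed.

Local Notation U := (Group tw_U_group).
Local Notation M := (Group tw_M_group).
Local Notation A := (Group tw_A_group).
Local Notation C := (Group tw_C_group).

Lemma tw_nA (g : gT) : g \in 'N(A).
Proof.
rewrite inE; apply/subsetP=> _ /imsetP[x + ->].
case: g x => [[u v] e] [[u' v'] e']; rewrite inE /=; case: e' => //= /andP[du /eqP->].
rewrite dihJ inE /=; case: e; rewrite /= ?oppr0 ?eqxx ?andbT //.
by rewrite (dvdn_ZpN r_gt1).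
Qed.

Lemma tw_nC (g : gT) : g \in 'N(C).
Proof.
rewrite inE; apply/subsetP=> _ /imsetP[x + ->].
case: g x => [[u v] e] [[u' v'] e']; rewrite inE /=; case: e' => //= /andP[/eqP-> bv].
rewrite dihJ inE /=; case: e; rewrite /= ?oppr0 ?eqxx //.
by rewrite (dvdn_ZpN s_gt1).
Qed.

Definition tw_rel := twisted_rel U M A C tw_th tw_th1.

Let sAU : A \subset U.
Proof. by apply/subsetP=> g; rewrite !inE => /and3P[-> ->]. Qed.

Let sAM : A \subset M.
Proof. by apply/subsetP=> g; rewrite !inE => /and3P[_ _ /eqP->]; rewrite dvdn0. Qed.

Let sCU : C \subset U.
Proof. by apply/subsetP=> g; rewrite !inE => /and3P[-> /eqP->]; rewrite dvdn0. Qed.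

Let sCM : C \subset M.
Proof. by apply/subsetP=> g; rewrite !inE => /and3P[_ _ ->]. Qed.

Let UM_AC (g : gT) : g \in U -> g \in M -> g \in (A * C)%g.
Proof.
case: g => [[u v] []]; rewrite !inE //= => du bv.
have -> : ((u, v), false) = ((((u, 0), false) : gT) * (((0, v), false) : gT))%g :> gT.
  by rewrite dihM; congr (_, _, _); rewrite /= ?addr0 ?add0r.
by apply: mem_mulg; rewrite !inE /= ?eqxx ?du ?bv.
Qed.

Let th1_U (g : gT) : (tw_th1 g \in U) = (g \in U).
Proof.
case: g => [[u v] []]; rewrite !inE //= subr0; exact: dvdn_ZpN.
Qed.

Let th_U (g : gT) : (tw_th g \in U) = (g \in U).
Proof.
case: g => [[u v] []]; rewrite !inE //= subr0; exact: dvdn_ZpN.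
Qed.

Let th1_M (g : gT) : (tw_th1 g \in M) = (g \in M).
Proof. by rewrite !inE. Qed.

Let th_M (g : gT) : (tw_th g \in M) = (g \in M).
Proof. by rewrite !inE /=; exact: dvdn_ZpN. Qed.

Let th1_modA (g : gT) : g \in U -> (g^-1 * tw_th1 g)%g \in A.
Proof.
case: g => [[u v] []]; rewrite !inE //= subr0 addNr eqxx andbT => du.
by rewrite (dvdn_ZpD r_gt1) // (dvdn_ZpN r_gt1).
Qed.

Let th1_modC (g : gT) : g \in M -> ((tw_th g)^-1 * tw_th1 g)%g \in C.
Proof.
case: g => [[u v] e]; rewrite !inE /tw_th /tw_th1 dihV dihM /= => bv.
case: e => /=; rewrite ?subrr ?addNr eqxx ?opprK /=.
  by rewrite (dvdn_ZpD s_gt1) // (dvdn_ZpN s_gt1).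
by rewrite (dvdn_ZpD s_gt1).
Qed.

Lemma tw_rel_Sring : Sring_rel tw_rel.
Proof.
apply: twisted_rel_Sring => //; try exact: tw_nA; try exact: tw_nC.
- exact: tw_thM.
- exact: tw_thK.
- exact: tw_th1M.
- exact: tw_th1K.
Qed.

Let classU (V : Type) (F : 'Z_s -> V) : (forall v, F (- v) = F v) ->
  class_fun tw_rel (fun g : gT =>
    if ~~ g.2 && (d %| g.1.1)%N then Some (F g.1.2) else None).
Proof.
move=> FN g h gh; rewrite -!(@in_set gT (fun g => ~~ g.2 && (d %| g.1.1)%N)).
apply: (twisted_class_funU sAU sCU th1_U th_U (F := fun g : gT => F g.1.2)) gh => [x|[[u v] e] [[u' v'] e']].
  by rewrite /= FN.
rewrite inE /= => /and3P[_ _ /eqP->].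
by case: e; rewrite /= ?oppr0 addr0.
Qed.

Let classM (V : Type) (F : 'Z_r -> bool -> V) :
  (forall u (e : bool), F (- u - e%:R) e = F u e) ->
  class_fun tw_rel (fun g : gT => if (b %| g.1.2)%N then Some (F g.1.1 g.2) else None).
Proof.
move=> FN g h gh; rewrite -!(@in_set gT (fun g => b %| g.1.2)%N).
apply: (twisted_class_funM sAM sCM th1_M th_M (F := fun g : gT => F g.1.1 g.2)) gh => [x|[[u v] e] [[u' v'] e']].
  by rewrite /= FN.
rewrite inE /= => /and3P[/negPf-> /eqP-> _].
by case: e; rewrite /= ?oppr0 addr0.
Qed.

Let classN (V : Type) (F : gT -> V) : (forall g, F (tw_th g) = F g) ->
  class_fun tw_rel (fun g : gT =>
    if [&& ~~ g.2, d %| g.1.1 & b %| g.1.2]%N then Some (F g) else None).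
Proof.
move=> FN g h gh; have := twisted_class_funN sAM sCU th1_U th_M th_U FN gh.
by rewrite !inE -!andbA.
Qed.

(* Following the orbit of y x_b shows that an automorphism sending it to
   th1 (y x_b) must act as -1 on A, hence on C, hence on the quotient of order
   b, although it fixes the image of y x_b there. *)
Lemma Schur_dihedral_twisted n : (0 < n)%N -> coprime r s -> (r * s %| n)%N ->
  ~ Schur_group ('D_(2 * n))%type.
Proof.
move=> n_gt0 co_rs rs_n schurD.
have n_gt1 : (1 < n)%N.
  by apply: leq_trans (dvdn_leq n_gt0 rs_n); rewrite (leq_trans r_gt1) // leq_pmulr // ltnW.
pose g0 : gT := ((0, 1), true).
have b1 : (b %| (1%R : 'Z_s))%N = false by rewrite (dvdn_Zp_nat s_gt1 bs 1) dvdn1; lia.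
have Rg0 : tw_rel g0 (tw_th1 g0).
  by rewrite /tw_rel /twisted_rel !inE /= b1 eqxx !orbT.
have [k [_ k1 kg0 kP]] := Schur_dihedral_class_fun schurD n_gt1 r_gt1 s_gt1 co_rs rs_n tw_rel_Sring Rg0.
have kP1 (V : eqType) (f : gT -> V) g : class_fun tw_rel f -> f (k g) = f g.
  by move=> fR; have := kP V f fR 1%g g; rewrite k1 invg1 !mulg1.
(* Generators of [A] and [C]; their orders [a] and [c] exceed 2, so neither equals its opposite. *)
pose al : 'Z_r := d%:R; pose ga : 'Z_s := b%:R.
have al_opp : al != - al.
  by apply: Zp_neq_opp => //; rewrite -mul2n dvdn_pmul2r ?(ltnW d_gt1) // gtnNdvd.
have ga_opp : ga != - ga.
  apply: Zp_neq_opp => //; rewrite -muln2 dvdn_pmul2l ?gtnNdvd //.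
  exact: ltn_trans b_gt2.
have one_opp : (1 : 'Z_s) != - 1.
  apply: (Zp_neq_opp (k := 1)) => //; rewrite gtnNdvd //.
  by rewrite (leq_trans b_gt2) // leq_pmulr // (ltn_trans _ c_gt2).
pose FM (u : 'Z_r) (e : bool) := [set (u, e); (- u - e%:R, e)].
have FM_sym u (e : bool) : FM (- u - e%:R) e = FM u e.
  by rewrite /FM (_ : - (- u - e%:R) - e%:R = u) 1?setUC //; ring.
pose FU (v : 'Z_s) := [set v; - v].
have FU_sym v : FU (- v) = FU v by rewrite /FU opprK setUC.
pose FN (g : gT) := [set g; tw_th g].
have FN_sym g : FN (tw_th g) = FN g by rewrite /FN tw_thK setUC.
pose y : gT := ((0, 0), true).
(* [g0 * y^-1] lies in [U] and [k g0] has first coordinate -1; since [d > 1], that of [k y] cannot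
   be 0. *)
have [v1 ky] : exists v1, k y = ((-1, v1), true).
  have := kP1 _ _ y (classM FM_sym); have := kP _ _ (classU FU_sym) y g0.
  rewrite kg0; case: (k y) => [[u1 v1] e1] /= EU; rewrite dvdn0; case: ifP => // _ [FE].
  have : (u1, e1) \in FM 0 true by rewrite -FE !inE eqxx.
  rewrite !inE !xpair_eqE => /orP[] /andP[/eqP u1E /eqP e1E]; rewrite u1E e1E in EU *.
    move: EU; rewrite /= !subr0 dvdn0 oppr0 sub0r (dvdn_ZpN r_gt1 dr).
    by rewrite (dvdn_Zp_nat r_gt1 dr 1) dvdn1 gtn_eqF.
  by exists v1; rewrite oppr0 add0r.
(* If this point were fixed, comparison with [k y] would put [al - 1] among [al] and [- al - 1]. *)
have kal : k ((al, 0), false) = ((- al, 0), false).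
  have := kP1 _ _ ((al, 0), false) (classN FN_sym).
  have := kP _ _ (classM FM_sym) y ((al, 0), false).
  rewrite ky; case: (k _) => [[u2 v2] e2] /= EM.
  rewrite (dvdn_Zp_nat r_gt1 dr) dvdnn dvdn0; case: ifP => // _ [FE].
  have : (u2, v2, e2) \in FN (al, 0, false) by rewrite -FE !inE eqxx.
  rewrite !inE /tw_th /= => /orP[] /eqP[u2E v2E e2E]; last first.
    by rewrite u2E v2E e2E subr0 oppr0.
  move: EM; rewrite u2E v2E e2E /= !addr0 dvdn0; case: ifP => // _ [{}FE].
  have : (al - 1, true) \in FM al true by rewrite -FE !inE eqxx.
  rewrite !inE !xpair_eqE !andbT => /orP[].
    by rewrite -subr_eq0 addrAC subrr sub0r oppr_eq0 oner_eq0.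
  by rewrite (inj_eq (addIr _)) (negPf al_opp).
(* On [AC] the classes are the orbits of [th], which inverts both coordinates at once, so inversion
   on [A] forces inversion on [C]. *)
have kga : k ((0, ga), false) = ((0, - ga), false).
  have := kP1 _ _ ((0, ga), false) (classN FN_sym).
  have := kP _ _ (classN FN_sym) ((al, 0), false) ((0, ga), false).
  rewrite kal; case: (k _) => [[u2 v2] e2] /= EN.
  rewrite (dvdn_Zp_nat s_gt1 bs) dvdnn dvdn0; case: ifP => // _ [FE].
  have : (u2, v2, e2) \in FN (0, ga, false) by rewrite -FE !inE eqxx.
  rewrite !inE /tw_th /= => /orP[] /eqP[u2E v2E e2E]; last first.
    by rewrite u2E v2E e2E subr0 oppr0.
  move: EN; rewrite u2E v2E e2E /= sub0r !(dvdn_ZpN r_gt1 dr) subr0.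
  rewrite (dvdn_Zp_nat r_gt1 dr) (dvdn_Zp_nat s_gt1 bs) !dvdnn; case: ifP => // _ [{}FE].
  pose elt (u : 'Z_r) (v : 'Z_s) : gT := ((u, v), false).
  have : (elt 0 ga * (elt (- al) 0)^-1)%g \in FN (elt 0 ga * (elt al 0)^-1)%g.
    by rewrite -FE !inE eqxx.
  rewrite /elt dihV !dihM !inE /tw_th !xpair_eqE /= !sub0r !subr0 opprK andbT.
  case/orP=> [/andP[/eqP al_eq _] | /andP[/andP[_ /eqP ga_eq] _]].
    by rewrite -al_eq eqxx in al_opp.
  by rewrite -ga_eq eqxx in ga_opp.
have [u2 kbe] : exists u2, k ((0, 1), false) = ((u2, -1), false).
  have := kP1 _ _ ((0, 1), false) (classU FU_sym).
  have := kP _ _ (classU FU_sym) ((0, ga), false) ((0, 1), false).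
  rewrite kga; case: (k _) => [[u2 v2] e2] /= EU.
  rewrite dvdn0; case: ifP => // /andP[/negPf e2E u2d] [FE].
  have : v2 \in FU 1 by rewrite -FE !inE eqxx.
  rewrite !inE => /orP[] /eqP v2E; last by exists u2; rewrite v2E e2E.
  move: EU; rewrite v2E e2E /= !subr0 dvdn0; case: ifP => // _ [{}FE].
  have : 1 - - ga \in FU (1 - ga) by rewrite -FE !inE eqxx.
  rewrite opprK !inE opprB (inj_eq (addrI _)) (negPf ga_opp) addrC.
  by rewrite (inj_eq (addrI _)) (negPf one_opp).
(* The quotient of these points has second coordinate 2, not a multiple of [b], so it is outside
   [M]; that of their images has second coordinate 0. *)
have := kP _ _ (classM FM_sym) ((0, 1), false) g0.
rewrite kg0 kbe /=.
have b2 : (b %| (1 + 1 : 'Z_s)%R)%N = false.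
  by rewrite (dvdn_Zp_nat s_gt1 bs 2) gtnNdvd.
by rewrite !opprK subrr dvdn0 b2.
Qed.

End TwistedDihedral.

(** * Power sums over finite fields *)

Section PowerSums.

Variable F : finFieldType.

Let card_gt0 : (0 < #|F|.-1)%N.
Proof. by rewrite -subn1 subn_gt0 finNzRing_gt1. Qed.

Lemma expf_card_pred (x : F) : x != 0 -> x ^+ #|F|.-1 = 1.
Proof.
move=> x0; apply: (mulfI x0); rewrite -exprS prednK ?mulr1 ?expf_card //.
by apply/card_gt0P; exists x.
Qed.

Lemma ex_expf_neq1 k : ~~ (#|F|.-1 %| k)%N -> exists2 g : F, g != 0 & g ^+ k != 1.
Proof.
move=> nk; pose r := (k %% #|F|.-1)%N; have r_gt0 : (0 < r)%N by rewrite lt0n.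
have rE (g : F) : g != 0 -> g ^+ k = g ^+ r.
  move=> g0; rewrite (divn_eq k #|F|.-1) exprD mulnC exprM.
  by rewrite expf_card_pred // expr1n mul1r.
apply/exists_inP; apply: contraT => /exists_inPn allk.
have P0 : 'X^r - 1 != 0 :> {poly F} by rewrite -size_poly_gt0 size_XnsubC.
have : (size (enum [pred x : F | x != 0%R]) < size ('X^r - 1 : {poly F})%R)%N.
  apply: max_poly_roots P0 _ (enum_uniq _); apply/allP=> x.
  rewrite mem_enum inE => x0; rewrite rootE !hornerE -rE // subr_eq0.
  by rewrite -[_ == _]negbK allk.
rewrite size_XnsubC // -cardE ltnS => le_r.
have : (#|F|.-1 <= r)%N by rewrite -(cardC1 (0 : F)).
by rewrite leqNgt ltn_mod card_gt0.
Qed.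

Lemma sum_exp_eq0 k : ~~ (#|F|.-1 %| k)%N -> \sum_(x : F) x ^+ k = 0.
Proof.
case/ex_expf_neq1=> g g0 gk.
apply/eqP; have := mulf_eq0 (g ^+ k - 1) (\sum_(x : F) x ^+ k).
rewrite subr_eq0 (negPf gk) /= => <-; rewrite mulrBl mul1r subr_eq0 mulr_sumr.
rewrite [X in _ == X](reindex_inj (mulfI g0)); apply/eqP/eq_bigr => x _.
by rewrite exprMn.
Qed.

(** Translation by 1 permutes the field, so the sum of all [x] equals the sum of all [x + 1]. *)
Lemma sum_exp0 : \sum_(x : F) x ^+ 0 = 0.
Proof.
apply: (addrI (\sum_(x : F) x)); rewrite addr0 -big_split /=.
by rewrite [RHS](reindex_inj (addIr 1)).
Qed.

Lemma sum_exp_card_pred : \sum_(x : F) x ^+ #|F|.-1 = -1.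
Proof.
transitivity (\sum_(x : F) (x ^+ #|F|.-1 - x ^+ 0)).
  by rewrite sumrB sum_exp0 subr0.
rewrite (bigD1 0) //= expr0n -[_ == _]negbK -lt0n card_gt0.
rewrite expr0 sub0r big1 ?addr0 // => x x0.
by rewrite expf_card_pred // expr0 subrr.
Qed.

Lemma sum_horner_eq0 (P : {poly F}) : (size P <= #|F|.-1)%N -> \sum_(x : F) P.[x] = 0.
Proof.
move=> szP; under eq_bigr do rewrite horner_coef.
rewrite exchange_big big1 //= => -[[|k] /= kP] _; rewrite -mulr_sumr.
  by rewrite sum_exp0 mulr0.
rewrite sum_exp_eq0 ?mulr0 // gtnNdvd //; exact: leq_trans szP.
Qed.

End PowerSums.

Lemma prime_fact_ndvd p n : prime p -> (n < p)%N -> ~~ (p %| n`!)%N.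
Proof.
move=> p_pr; elim: n => [|n IHn] np; first by rewrite fact0 dvdn1 neq_ltn prime_gt1 ?orbT.
by rewrite factS Euclid_dvdM // negb_or gtnNdvd // IHn // ltnW.
Qed.

(* The sum is a binomial coefficient C(3m, m), up to sign. *)
Lemma sum_cube_neq0 p m : prime p -> p = (4 * m).+1 ->
  \sum_(x : 'F_p) (x - 1) ^+ (3 * m) * x ^+ (3 * m) != 0.
Proof.
move=> p_pr pE; have cF : (#|'F_p|.-1 = 4 * m)%N by rewrite card_Fp // pE.
have m_gt0 : (0 < m)%N by case: m pE p_pr {cF} => // ->.
have -> : \sum_(x : 'F_p) (x - 1) ^+ (3 * m) * x ^+ (3 * m)
    = - ((-1) ^+ (2 * m) *+ 'C(3 * m, 2 * m)).
  under eq_bigr do rewrite exprDn mulr_suml.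
  (* The exponents [6m - i] with [i <= 3m] run from [3m] to [6m]; the only multiple of [4m] among
     them is [4m], for [i = 2m]. *)
  have i0_lt : (2 * m < (3 * m).+1)%N by lia.
  rewrite exchange_big (bigD1 (Ordinal i0_lt)) //= [X in _ + X]big1 ?addr0 => [|i ni].
    transitivity (\sum_(x : 'F_p) x ^+ (4 * m) * ((-1) ^+ (2 * m) *+ 'C(3 * m, 2 * m))).
      apply: eq_bigr => x _; rewrite mulrnAr mulrnAl mulrAC -exprD.
      by congr (_ ^+ _ * _ *+ _); lia.
    by rewrite -mulr_suml -cF sum_exp_card_pred mulN1r.
  under eq_bigr do rewrite mulrnAl mulrAC -exprD -mulrnAr.
  rewrite -mulr_suml sum_exp_eq0 ?mul0r // cF.
  apply: contra ni => /dvdnP[q qE]; apply/eqP/val_inj => /=.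
  have := ltn_ord i; have : (q = 0 \/ q = 1 \/ 2 <= q)%N by lia.
  by case=> [q0|[q1|q2]]; nia.
rewrite oppr_eq0 -mulr_natr mulf_neq0 ?signr_eq0 //.
rewrite -(dvdn_pcharf (pchar_Fp p_pr)).
have := bin_fact (_ : 2 * m <= 3 * m)%N => /(_ ltac:(lia)) binE.
apply/negP=> pC; have : (p %| (3 * m)`!)%N by rewrite -binE dvdn_mulr.
by apply/negP/prime_fact_ndvd; rewrite // pE; lia.
Qed.

(** The quartic character [x |-> x ^+ m] in additive form: if [g ^+ (2 * m) != 1], then [z = g ^+ m]
    has order exactly 4, and [eta] is the logarithm of the character to base [z]. *)
Lemma quartic_log p m : prime p -> p = (4 * m).+1 ->
  exists (z : 'F_p) (eta : 'F_p -> 'Z_4),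
    [/\ 4.-primitive_root z, forall x, x != 0 -> x ^+ m = z ^+ eta x,
        forall x y, x != 0 -> y != 0 -> eta (x * y) = eta x + eta y
      & exists2 g, g != 0 & eta g = 1].
Proof.
move=> p_pr pE; have cF : (#|'F_p|.-1 = 4 * m)%N by rewrite card_Fp // pE.
have m_gt0 : (0 < m)%N by case: m pE p_pr {cF} => // ->.
have [g g0 g2m] : exists2 g : 'F_p, g != 0 & g ^+ (2 * m) != 1.
  by apply: ex_expf_neq1; rewrite cF gtnNdvd //; lia.
have m4 (x : 'F_p) : x != 0 -> (x ^+ m) ^+ 4 = 1.
  by move=> x0; rewrite -exprM mulnC -cF expf_card_pred.
pose z := g ^+ m; have z_prim : 4.-primitive_root z.
  have [k k_prim k4] := prim_order_exists (isT : (0 < 4)%N) (m4 g g0).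
  have := dvdn_leq (isT : (0 < 4)%N) k4; case: k k_prim k4 => [|[|[|[|[|]]]]] // kz _ _.
    have z1 : z = 1 := prim_expr_order kz.
    by case/eqP: g2m; rewrite mulnC exprM -/z z1 expr1n.
  by case/eqP: g2m; rewrite mulnC exprM -/z (prim_expr_order kz).
pose eta (x : 'F_p) : 'Z_4 := odflt 0 [pick j : 'Z_4 | x ^+ m == z ^+ j].
have etaE x : x != 0 -> x ^+ m = z ^+ eta x.
  move=> x0; have [i xi] := prim_rootP z_prim (m4 x x0).
  by rewrite /eta; case: pickP => [j /eqP|/(_ i)] //; rewrite xi eqxx.
have eta_inj (i j : 'Z_4) : z ^+ i = z ^+ j -> i = j.
  move/eqP; rewrite (eq_prim_root_expr z_prim) !modn_small ?ltn_ord // => /eqP.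
  exact: val_inj.
exists z, eta; split=> // [x y x0 y0|].
  apply: eta_inj; rewrite -etaE ?mulf_neq0 // exprMn !etaE // -exprD.
  by rewrite -(prim_expr_mod z_prim).
by exists g => //; apply: eta_inj; rewrite -etaE // expr1.
Qed.

(** * Multiples of 4p, p = 1 mod 4 *)

Section QuarticDihedral.

Variables (p m : nat) (z : 'F_p) (eta : 'F_p -> 'Z_4).
Hypotheses (p_pr : prime p) (pE : p = (4 * m).+1).
Hypothesis z_prim : 4.-primitive_root z.
Hypothesis etaE : forall x, x != 0 -> x ^+ m = z ^+ eta x.
Hypothesis etaM : forall x y, x != 0 -> y != 0 -> eta (x * y) = eta x + eta y.
Hypothesis eta1_ex : exists2 g, g != 0 & eta g = 1.

Local Notation gT := (dih ('Z_4 * 'F_p)%type).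

Let eta1 : eta 1 = 0.
Proof. by apply: (addrI (eta 1)); rewrite -etaM ?mulr1 ?addr0 ?oner_neq0. Qed.

Let etaV x : x != 0 -> eta x^-1 = - eta x.
Proof.
by move=> x0; apply: (addrI (eta x)); rewrite -etaM ?invr_eq0 // mulfV // subrr.
Qed.

Let eta_surj (t : 'Z_4) : exists2 a, a != 0 & eta a = t.
Proof.
have [g g0 g1] := eta1_ex; exists (g ^+ t); first by rewrite expf_neq0.
rewrite -[RHS]natr_Zp; elim: (nat_of_ord t) => [|k IHk]; first by rewrite expr0.
by rewrite exprS etaM ?expf_neq0 // IHk g1 mulrS.
Qed.

Definition qmu (a : 'F_p) (g : gT) : gT :=
  ((g.1.1 + (if g.2 then eta a else 0), a * g.1.2), g.2).
(** The maps [qmu] leave [j] invariant on rotations and [j - eta i] on reflections with [i != 0];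
    [qsw] changes the sign of this invariant. *)
Definition qsw (g : gT) : gT :=
  ((if g.2 then 2%:R * eta g.1.2 - g.1.1 else - g.1.1, g.1.2), g.2).

(* The orbits of the automorphisms qmu a (x -> x^a, y -> w^(eta a) y) form a
   schurian S-ring; qsw fuses its classes along complex conjugation of the
   quartic character. *)
Definition quartic_rel : rel gT := fun g h =>
  [exists a, (a != 0) && (h == qmu a g)]
  || ~~ (g.2 && (g.1.2 == 0)) && (h == qsw g).

Lemma qmuM a : {morph qmu a : g h / (g * h)%g}.
Proof.
move=> [[j i] e] [[j' i'] e']; rewrite !dihM /qmu /=; congr (_, _, _).
  by case: e e' => -[] /=; ring.
by case: e; rewrite /=; ring.
Qed.

Lemma qmuV a g : qmu a g^-1%g = (qmu a g)^-1%g.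
Proof.
have qmu1 : qmu a 1%g = 1%g by apply: (mulgI (qmu a 1%g)); rewrite -qmuM !mulg1.
by apply: (mulgI (qmu a g)); rewrite -qmuM !mulgV.
Qed.

Lemma qmuK a : a != 0 -> cancel (qmu a) (qmu a^-1).
Proof.
move=> a0 [[j i] e]; rewrite /qmu /= mulKf //.
by case: e; rewrite ?addr0 //= etaV // addrK.
Qed.

Section QuarticClassFun.

Variables (V : Type) (f : gT -> V).
Hypothesis fR : class_fun quartic_rel f.

Lemma quartic_qmu a g : a != 0 -> f (qmu a g) = f g.
Proof.
move=> a0; apply/esym/fR/orP; left; apply/existsP; exists a.
by rewrite a0 eqxx.
Qed.

Lemma quartic_rot j i i' : (i == 0) = (i' == 0) ->
  f ((- j, i'), false) = f ((j, i), false).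
Proof.
move=> ii'; have sw x : f ((- j, x), false) = f ((j, x), false).
  by apply/esym/fR/orP; right; rewrite /= eqxx.
rewrite -sw; have [i0|i0] := eqVneq i 0.
  by move: ii'; rewrite i0 eqxx => /esym/eqP->.
have i'0 : i' != 0 by rewrite -ii'.
rewrite -(quartic_qmu ((- j, i), false) (a := i' / i)) ?mulf_neq0 ?invr_eq0 // /qmu /= addr0.
by rewrite divfK.
Qed.

Lemma quartic_refl j i i' : i != 0 -> i' != 0 ->
  f ((eta i + eta i' - j, i'), true) = f ((j, i), true).
Proof.
move=> i0 i'0; have -> : f ((j, i), true) = f (qsw ((j, i), true)).
  by apply/fR/orP; right; rewrite /= i0 eqxx.
rewrite -(quartic_qmu (qsw ((j, i), true)) (a := i' / i)) ?mulf_neq0 ?invr_eq0 //.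
rewrite /qmu /qsw /=.
rewrite divfK // etaM ?invr_eq0 // etaV //; congr (f ((_, _), _)); ring.
Qed.

Lemma quartic_refl0 j j' : f ((j', 0), true) = f ((j, 0), true).
Proof.
have [a a0 aE] := eta_surj (j' - j).
by rewrite -(quartic_qmu ((j, 0), true) a0) /qmu /= mulr0 aE addrC subrK.
Qed.

End QuarticClassFun.

Lemma quartic_relV V (f : gT -> V) : class_fun quartic_rel f ->
  forall g h, quartic_rel g h -> f g^-1%g = f h^-1%g.
Proof.
move=> fR g h /orP[/existsP[a /andP[a0 /eqP->]] | /andP[ng /eqP->]].
  by rewrite -qmuV quartic_qmu.
case: g ng => [[j i] []]; rewrite /qsw !dihV /= => i0.
  by rewrite -(quartic_refl fR j i0 i0); congr (f ((_, _), _)); ring.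
by apply/esym/(quartic_rot fR).
Qed.

Let pairB (a b : 'Z_4) (x y : 'F_p) : (a, x) - (b, y) = (a - b, x - y).
Proof. by []. Qed.

Let pairD (a b : 'Z_4) (x y : 'F_p) : (a, x) + (b, y) = (a + b, x + y).
Proof. by []. Qed.

(** Exactly one of [k] and [g * k^-1] is a reflection, and its second coordinate undergoes the
    inversion [x |-> d ^+ 2 / x]. This fixes [d], and also 0 since [0^-1 = 0], and it reflects [eta]
    about [eta d], as [qsw g] requires. *)
Let conv_refl (f1 f2 : gT -> int) (l : 'Z_4) (d : 'F_p) : d != 0 ->
  class_fun quartic_rel f1 -> class_fun quartic_rel f2 ->
  let g : gT := ((l, d), true) in
  \sum_k f1 k * f2 (g * k^-1)%g = \sum_k f1 k * f2 (qsw g * k^-1)%g.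
Proof.
move=> d0 f1R f2R g.
pose phi (h : gT) : gT := if h.2 then ((2%:R * eta d - h.1.1, d ^+ 2 / h.1.2), true)
  else ((- h.1.1, d ^+ 2 / (d + h.1.2) - d), false).
have inv_inv (x : 'F_p) : d ^+ 2 / (d ^+ 2 / x) = x.
  have [->|x0] := eqVneq x 0; first by rewrite invr0 mulr0 invr0 mulr0.
  by field; rewrite x0 d0.
have div_d2 (x : 'F_p) : (d ^+ 2 / x == d) = (x == d).
  have dd : d ^+ 2 / d = d by rewrite expr2 mulfK.
  by apply/eqP/eqP=> [E|->//]; rewrite -[x]inv_inv E dd.
have eta_d2 (x : 'F_p) : x != 0 -> eta (d ^+ 2 / x) = 2%:R * eta d - eta x.
  move=> x0; rewrite etaM ?invr_eq0 ?expf_neq0 // etaV // expr2 etaM //; ring.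
apply: (eq_conv (phi := phi)).
- apply: inv_inj => -[[j i] []]; rewrite /phi /=; congr (_, _, _).
  + ring.
  + exact: inv_inv.
  + ring.
  by rewrite [d + (_ - d)]addrC subrK inv_inv addrC addKr.
- move=> [[j i] []]; rewrite /phi /=; last first.
    apply: (quartic_rot f1R); rewrite subr_eq0 div_d2.
    by rewrite -[X in _ = (_ == X)]addr0 (inj_eq (addrI _)).
  have [->|i0] := eqVneq i 0; first by rewrite invr0 mulr0; apply: quartic_refl0.
  have i'0 : d ^+ 2 / i != 0 by rewrite mulf_neq0 ?invr_eq0 ?expf_neq0.
  by rewrite -(quartic_refl f1R j i0 i'0) eta_d2 //; congr (f1 ((_, _), _)); ring.
move=> [[j i] []]; rewrite /phi /g /qsw !dihV !dihM /= ?opprK ?pairB ?pairD.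
  have -> : 2%:R * eta d - l - (2%:R * eta d - j) = - (l - j) by ring.
  apply: (quartic_rot f2R); rewrite !subr_eq0 eq_sym [RHS]eq_sym.
  by rewrite div_d2.
rewrite [d + (_ - d)]addrC subrK; have [di0|di0] := eqVneq (d + i) 0.
  by rewrite di0 invr0 mulr0; apply: (quartic_refl0 f2R).
have i'0 : d ^+ 2 / (d + i) != 0 by rewrite mulf_neq0 ?invr_eq0 ?expf_neq0.
by rewrite -(quartic_refl f2R (l + j) di0 i'0) eta_d2 //; congr (f2 ((_, _), _)); ring.
Qed.

Let conv_rot (f1 f2 : gT -> int) (l : 'Z_4) (d : 'F_p) :
  class_fun quartic_rel f1 -> class_fun quartic_rel f2 ->
  let g : gT := ((l, d), false) in
  \sum_k f1 k * f2 (g * k^-1)%g = \sum_k f1 k * f2 (qsw g * k^-1)%g.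
Proof.
move=> f1R f2R g.
(* On reflections [i |-> - d - i] exchanges, up to sign, the coordinates [i] of [k] and [d + i] of
   [g * k^-1]. Where one of them vanishes, [i] is kept and only [j] is reflected. *)
pose phi (h : gT) : gT := let: ((j, i), e) := h in
  if ~~ e then ((- j, i), false) else
  if i == 0 then ((2%:R * eta d - j, i), true) else
  if i == - d then ((2%:R * eta i - j, i), true)
  else ((eta (- d - i) + eta i - j, - d - i), true).
apply: (eq_conv (phi := phi)).
- apply: inv_inj => -[[j i] []]; rewrite /phi /=; last by rewrite opprK.
  case: (eqVneq i 0) => [->|i0]; first by rewrite eqxx; congr (_, _, _); ring.
  case: (eqVneq i (- d)) => [E|id].
    by rewrite (negPf i0) E eqxx; congr (_, _, _); ring.
  have -> : (- d - i == - d) = false.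
    by rewrite -[X in _ == X]addr0 (inj_eq (addrI _)) oppr_eq0 (negPf i0).
  rewrite subr_eq0 eq_sym (negPf id).
  have -> : - d - (- d - i) = i by ring.
  by congr (_, _, _); ring.
- move=> [[j i] []]; rewrite /phi /=; last exact: (quartic_rot f1R).
  case: (eqVneq i 0) => [->|i0]; first exact: (quartic_refl0 f1R).
  case: (eqVneq i (- d)) => [E|id].
    by rewrite -[in RHS](quartic_refl f1R j i0 i0); congr (f1 ((_, _), _)); ring.
  rewrite addrC -[RHS](@quartic_refl _ f1 f1R j i (- d - i)) //.
    by congr (f1 ((_, _), _)); ring.
  by rewrite subr_eq0 eq_sym.
move=> [[j i] []]; rewrite /phi /g /qsw !dihV !dihM /= ?opprK ?pairB ?pairD; last first.
  by have -> : - l - - j = - (l - j) by [ring]; apply: (quartic_rot f2R).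
case: (eqVneq i 0) => [->|i0]; rewrite /= ?pairD.
  rewrite !addr0; have [->|d0] := eqVneq d 0; first exact: (quartic_refl0 f2R).
  by rewrite -[in RHS](quartic_refl f2R (l + j) d0 d0); congr (f2 ((_, _), _)); ring.
case: (eqVneq i (- d)) => [E|id]; rewrite /= ?pairD.
  by rewrite E subrr; apply: (quartic_refl0 f2R).
have di0 : d + i != 0 by rewrite addrC addr_eq0.
have ni0 : - i != 0 by rewrite oppr_eq0.
have ndi0 : - d - i != 0 by rewrite -opprD oppr_eq0.
have -> : d + (- d - i) = - i by ring.
rewrite -(quartic_refl f2R (l + j) di0 ni0).
have -> : eta (d + i) + eta (- i) = eta (- d - i) + eta i.
  by rewrite -!etaM //; congr eta; ring.
by congr (f2 ((_, _), _)); ring.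
Qed.

Lemma quartic_rel_Sring : Sring_rel quartic_rel.
Proof.
split.
- have qmu1 a : qmu a 1%g = 1%g by apply: (mulgI (qmu a 1%g)); rewrite -qmuM !mulg1.
  move=> g /orP[] /orP[/existsP[a /andP[a0 /eqP E]]|/andP[ng /eqP E]].
  + by rewrite E qmu1.
  + by rewrite E /qsw /= oppr0.
  + by rewrite -(qmuK a0 g) -E qmu1.
  + case: g ng E => [[j i] []]; rewrite /qsw /= => _ E; first by case/(congr1 snd): E.
    have Ej : 0 = - j := congr1 (fun h : gT => h.1.1) E.
    have Ei : 0 = i := congr1 (fun h : gT => h.1.2) E.
    by rewrite -(opprK j) -Ej -Ei oppr0.
- by move=> f fR g h; apply: quartic_relV.
move=> f1 f2 f1R f2R g h /orP[/existsP[a /andP[a0 /eqP->]]|/andP[ng /eqP->]].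
  apply: (eq_conv (phi := qmu a)) => [|k|k]; first exact: can_inj (qmuK a0).
    exact: quartic_qmu.
  by rewrite -qmuV -qmuM quartic_qmu.
case: g ng => [[l d] []] /= d0; last exact: conv_rot.
exact: conv_refl.
Qed.

Definition quartic_color (g : gT) : bool * bool * {set 'Z_4} :=
  (g.2, g.1.2 == 0,
   if ~~ g.2 then [set g.1.1; - g.1.1] else
   if g.1.2 == 0 then set0 else [set g.1.1 - eta g.1.2; eta g.1.2 - g.1.1]).

Lemma quartic_color_class : class_fun quartic_rel quartic_color.
Proof.
move=> [[j i] e] h /orP[/existsP[a /andP[a0 /eqP->]] | /andP[ng /eqP->]].
  rewrite /quartic_color /= mulf_eq0 (negPf a0) /=; congr (_, _, _).
  case: e; rewrite /= ?addr0 //; case: eqVneq => // i0; rewrite etaM //.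
  by congr [set _; _]; ring.
rewrite /quartic_color /=; case: e ng => /= i0; congr (_, _, _); last first.
  by rewrite opprK setUC.
by rewrite (negPf i0) setUC; congr [set _; _]; ring.
Qed.

(* An automorphism fixing 1 and sending w to w^-1 would permute F_p so as to
   conjugate the quartic character, up to factors depending on one argument:
   phi(pi u - pi c) = b_c phi(u - c)^3 where phi(x) = x^m. *)
Lemma Schur_dihedral_quartic n : (0 < n)%N -> (4 * p %| n)%N ->
  ~ Schur_group ('D_(2 * n))%type.
Proof.
move=> n_gt0 p4n schurD; have p_gt1 := prime_gt1 p_pr.
have n_gt1 : (1 < n)%N.
  by apply: leq_trans (dvdn_leq n_gt0 p4n); rewrite (leq_trans p_gt1) // leq_pmull.
(* ['F_p] stands for ['Z_(pdiv p)], so the general result is applied with [pdiv p]. *)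
have pd : pdiv p = p by exact: pdiv_id.
have co : coprime 4 (pdiv p).
  by rewrite pd (_ : 4 = 2 ^ 2)%N // coprimeXl // coprime2n pE /= oddM.
pose w : gT := ((1, 0), false); pose w' : gT := ((-1, 0), false).
have Rww' : quartic_rel w w' by rewrite /quartic_rel /= eqxx orbT.
have pd_gt1 : (1 < pdiv p)%N by rewrite pd.
have pd4n : (4 * pdiv p %| n)%N by rewrite pd.
have [k [k_inj k1 kw kP]] :=
  Schur_dihedral_class_fun schurD n_gt1 (isT : 1 < 4)%N pd_gt1 co pd4n quartic_rel_Sring Rww'.
have kC g h : quartic_color (k h * (k g)^-1)%g = quartic_color (h * g^-1)%g.
  exact: kP quartic_color_class g h.
have kC1 g : quartic_color (k g) = quartic_color g.
  by have := kC 1%g g; rewrite k1 invg1 !mulg1.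
have k0 u : exists v, k ((0, u), false) = ((0, v), false).
  have := kC1 ((0, u), false); case: (k _) => [[j i] e]; rewrite /quartic_color /=.
  case=> -> _; rewrite oppr0 => E; exists i.
  have : j \in [set 0; 0] by rewrite -E !inE eqxx.
  by rewrite !inE orbb => /eqP->.
pose pi u := (k ((0, u), false)).1.2.
have kpi u : k ((0, u), false) = ((0, pi u), false).
  by rewrite /pi; have [v ->] := k0 u.
have kpi1 u : k ((1, u), false) = ((-1, pi u), false).
  have := kC w ((1, u), false); have := kC ((0, u), false) ((1, u), false).
  rewrite kw kpi; case: (k _) => [[j i] e].
  rewrite /quartic_color !dihV !dihM /= ?pairB ?pairD.
  case: e => [[]//|] /=; rewrite ?pairB /= !subr0 subrr eqxx => -[/eqP + E1].
  move/eqP; rewrite subr_eq0 => /eqP ->; have : j \in [set 1; -1] by rewrite -E1 !inE eqxx.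
  rewrite !inE => /orP[] /eqP-> //; rewrite ?pairB /= => -[_].
  rewrite opprK subrr oppr0 => E2; have : 1 + 1 \in [set (0 : 'Z_4); 0].
    by rewrite -E2 !inE eqxx.
  by rewrite !inE.
have pi_inj : injective pi.
  by move=> u v E; have := kpi v; rewrite -E -kpi => /k_inj/(congr1 (fun g : gT => g.1.2)).
(* Comparing [(0, u)] with a reflection at [- c] gives [l - eta (pi u - pi c)] up to sign. The point
   [(1, u)], whose image has first coordinate -1, settles the sign. *)
have kpi2 c : exists l, forall u, u != c -> eta (pi u - pi c) = l - eta (u - c).
  pose h : gT := ((0, - c), true).
  have := kC1 h; have := fun j u => kC ((j, u), false) h.
  case: (k h) => [[l v] e] hC; rewrite /quartic_color => -[e1 _ _].
  exists l => u uc; have := hC 0 c; have := hC 0 u; have := hC 1 u.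
  rewrite !kpi kpi1 e1 /h /quartic_color !dihV !dihM /= ?pairB ?pairD.
  have piuc : (pi u - pi c == 0) = false by rewrite subr_eq0 (inj_eq pi_inj) (negPf uc).
  rewrite !opprK addNr eqxx ![- c + u]addrC subr_eq0 (negPf uc) => E1 E0 -[/eqP].
  move/eqP; rewrite addr_eq0 => /eqP vE _; move: E1 E0; rewrite vE ![- pi c + _]addrC piuc.
  rewrite !addr0 add0r sub0r => -[E1] [E0].
  have : l - eta (pi u - pi c) \in [set - eta (u - c); eta (u - c)].
    by rewrite subr0 in E0; rewrite -E0 !inE eqxx.
  have : l - 1 - eta (pi u - pi c) \in [set 1 - eta (u - c); eta (u - c) - 1].
    by rewrite -E1 !inE eqxx.
  rewrite !inE addrAC => H1 /orP[/eqP sE|/eqP sE]; last first.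
    by apply: (canRL (subrK _)); rewrite -sE; ring.
  move: H1; rewrite sE => /orP[/eqP H|/eqP H].
    have : (1 + 1 : 'Z_4) == 0.
      rewrite (_ : 1 + 1 = (1 - eta (u - c)) - (- eta (u - c) - 1)); last by ring.
      by rewrite H subrr.
    by [].
  have e2 : - eta (u - c) = eta (u - c) by apply: (addIr (-1)).
  by apply: (canRL (subrK _)); rewrite -e2 -sE; ring.
have pi_pow c : exists2 B : 'F_p, B != 0 & forall u, (pi u - pi c) ^+ m = B * (u - c) ^+ (3 * m).
  have [l lP] := kpi2 c; exists (z ^+ l) => [|u].
    rewrite expf_neq0 //; apply/eqP=> z0; have := prim_expr_order z_prim.
    by rewrite z0 expr0n => /esym/eqP; rewrite oner_eq0.
  have m_gt0 : (0 < m)%N by case: (m) pE p_pr => // ->.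
  have [->|uc] := eqVneq u c; first by rewrite !subrr !expr0n muln_eq0 /= eqn0Ngt m_gt0 mulr0.
  have uc0 : u - c != 0 by rewrite subr_eq0.
  have piuc0 : pi u - pi c != 0 by rewrite subr_eq0 (inj_eq pi_inj).
  have prod : (pi u - pi c) ^+ m * (u - c) ^+ m = z ^+ l.
    rewrite !etaE // -exprD -(prim_expr_mod z_prim); congr (z ^+ _).
    by rewrite -[RHS](congr1 val (subrK (eta (u - c)) l)) -lP.
  have m4 : (u - c) ^+ m * (u - c) ^+ (3 * m) = 1.
    by rewrite -exprD -mulSn mulnC exprM etaE // -exprM mulnC exprM (prim_expr_order z_prim) expr1n.
  by rewrite -prod -mulrA m4 mulr1.
have [B1 B1_neq0 B1P] := pi_pow 1; have [B0 B0_neq0 B0P] := pi_pow 0.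
(* Reindexed by [pi], this is the sum of a polynomial of degree [2m < p - 1]; rewritten by [pi_pow],
   it is a nonzero multiple of the sum in [sum_cube_neq0]. *)
have /eqP : \sum_(u : 'F_p) (pi u - pi 1) ^+ m * (pi u - pi 0) ^+ m = 0.
  transitivity (\sum_(x : 'F_p) (x - pi 1) ^+ m * (x - pi 0) ^+ m).
    by rewrite [RHS](reindex_inj pi_inj).
  pose P : {poly 'F_p} := ('X - (pi 1)%:P) ^+ m * ('X - (pi 0)%:P) ^+ m.
  rewrite -[RHS](@sum_horner_eq0 _ P).
    by apply: eq_bigr => x _; rewrite !hornerE.
  rewrite (leq_trans (size_polyMleq _ _)) // !size_exp_XsubC card_Fp // pE /=; lia.
under eq_bigr do rewrite B1P B0P subr0 mulrACA.
rewrite -mulr_sumr mulf_eq0 (negPf (mulf_neq0 B1_neq0 B0_neq0)) /=.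
exact/negP/sum_cube_neq0.
Qed.

End QuarticDihedral.

(** * Multiples of 4p, p = 3 mod 4 *)

Lemma sum_dih (A : finZmodType) (F : dih A -> int) :
  \sum_g F g = \sum_a F (a, false) + \sum_a F (a, true).
Proof.
transitivity (\sum_(g : A * bool) F (g.1, g.2)); first by apply: eq_bigr => -[].
rewrite -(pair_bigA _ (fun a e => F (a, e))) -big_split.
by apply: eq_bigr => a _; rewrite big_bool /= [LHS]addrC.
Qed.

Lemma sum_pair (I J : finType) (F : I * J -> int) :
  \sum_g F g = \sum_j \sum_i F (i, j).
Proof.
rewrite exchange_big pair_bigA; apply: eq_bigr => -[]; by [].
Qed.

Section PaleyDihedral.

Variables (p m : nat).
Hypotheses (p_pr : prime p) (pE : p = (4 * m).+3) (m_gt0 : (0 < m)%N).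

Local Notation gT := (dih ('Z_4 * 'F_p)%type).

(** Euler's criterion for nonzero squares, as [(p - 1) / 2 = 2m + 1]; this exponent is odd, so -1 is
    not a square. *)
Definition qr (x : 'F_p) : bool := x ^+ (2 * m).+1 == 1.

Lemma qr_cases (x : 'F_p) : x != 0 -> x ^+ (2 * m).+1 = if qr x then 1 else -1.
Proof.
rewrite /qr => x0; case: eqP => // /eqP xh; apply/eqP.
have : (x ^+ (2 * m).+1) ^+ 2 == 1.
  rewrite -exprM (_ : _ * 2 = #|'F_p|.-1)%N ?expf_card_pred //.
  by rewrite card_Fp // pE; lia.
by rewrite sqrf_eq1 (negPf xh).
Qed.

Lemma Fp_neq_opp1 : (1 : 'F_p) != -1.
Proof.
rewrite -addr_eq0 -(natrD _ 1 1) -(dvdn_pcharf (pchar_Fp p_pr)) gtnNdvd // pE; lia.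
Qed.

Lemma qr0 : qr 0 = false.
Proof. by rewrite /qr expr0n eq_sym oner_eq0. Qed.

Lemma qr1 : qr 1 = true.
Proof. by rewrite /qr expr1n eqxx. Qed.

Lemma qr_neq0 x : qr x -> x != 0.
Proof. by apply: contraTneq => ->; rewrite qr0. Qed.

Lemma qrM x y : x != 0 -> y != 0 -> qr (x * y) = (qr x == qr y).
Proof.
move=> x0 y0; rewrite {1}/qr exprMn !qr_cases //.
have [n1 n2] := (Fp_neq_opp1, Fp_neq_opp1); rewrite eq_sym in n2.
by do 2!case: qr; rewrite /= ?mulr1 ?mul1r ?mulrNN ?mulr1 ?eqxx ?(negPf n2).
Qed.

Lemma qrN x : x != 0 -> qr (- x) = ~~ qr x.
Proof.
move=> x0; have qN1 : qr (-1) = false.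
  by rewrite /qr -signr_odd /= oddM /= expr1 eq_sym (negPf Fp_neq_opp1).
by rewrite -mulN1r qrM ?oppr_eq0 ?oner_eq0 // qN1; case: qr.
Qed.

Lemma qrMl a x : qr a -> qr (a * x) = qr x.
Proof.
move=> qa; have [->|x0] := eqVneq x 0; first by rewrite mulr0.
by rewrite qrM ?qa ?(qr_neq0 qa).
Qed.

Definition pmu (a : 'F_p) (g : gT) : gT := ((g.1.1, a * g.1.2), g.2).
Definition pnu (g : gT) : gT := ((- g.1.1, - g.1.2), g.2).

(* The reflections are classified by the Paley difference set; among the
   rotations, w x^i is fused with w^-1 x^-i, which yields the Paley tournament. *)
Definition paley_rel : rel gT := fun g h =>
  [|| [exists a, qr a && (h == pmu a g)], ~~ g.2 && (h == pnu g)
    | [&& g.2, h.2 & qr g.1.2 == qr h.1.2]].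

Lemma pmuM a : {morph pmu a : g h / (g * h)%g}.
Proof.
move=> [[j i] e] [[j' i'] e']; rewrite !dihM /pmu /=; congr (_, _, _).
  by case: e.
by case: e; rewrite /= ?mulrDr ?mulrN.
Qed.

Lemma pmuV a g : pmu a g^-1%g = (pmu a g)^-1%g.
Proof.
have pmu1 : pmu a 1%g = 1%g by apply: (mulgI (pmu a 1%g)); rewrite -pmuM !mulg1.
by apply: (mulgI (pmu a g)); rewrite -pmuM !mulgV.
Qed.

Lemma pmuK a : a != 0 -> cancel (pmu a) (pmu a^-1).
Proof. by move=> a0 [[j i] e]; rewrite /pmu /= mulKf. Qed.

Section PaleyClassFun.

Variables (V : Type) (f : gT -> V).
Hypothesis fR : class_fun paley_rel f.

Lemma paley_pmu a g : qr a -> f (pmu a g) = f g.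
Proof.
by move=> qa; apply/esym/fR/orP; left; apply/existsP; exists a; rewrite qa eqxx.
Qed.

Lemma paley_pnu j i : f ((- j, - i), false) = f ((j, i), false).
Proof. by apply/esym/fR/or3P/Or32; rewrite /= eqxx. Qed.

Lemma paley_refl j i j' i' : qr i = qr i' -> f ((j, i), true) = f ((j', i'), true).
Proof. by move=> ii'; apply/fR/or3P/Or33; rewrite /= ii' eqxx. Qed.

End PaleyClassFun.

Let pairB (a b : 'Z_4) (x y : 'F_p) : (a, x) - (b, y) = (a - b, x - y).
Proof. by []. Qed.

Let pairD (a b : 'Z_4) (x y : 'F_p) : (a, x) + (b, y) = (a + b, x + y).
Proof. by []. Qed.

Lemma paley_relV V (f : gT -> V) : class_fun paley_rel f ->
  forall g h, paley_rel g h -> f g^-1%g = f h^-1%g.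
Proof.
move=> fR g h gh; case/or3P: (gh) => [/existsP[a /andP[a0 /eqP->]] | /andP[ng /eqP->]|].
- by rewrite -pmuV paley_pmu.
- case: g {gh} ng => [[j i] []]; rewrite /pnu !dihV //= => _.
  by apply/esym/(paley_pnu fR).
by case: g h gh => [[j i] e] [[j' i'] e'] /= gh /and3P[-> -> /eqP E]; apply: paley_refl.
Qed.

(** If [i' / i] is not a square, its opposite is; [paley_pnu] then supplies the sign, and the
    accompanying [j |-> - j] does not affect the sum. *)
Let sum_rot (f : gT -> int) i i' : class_fun paley_rel f -> i != 0 -> i' != 0 ->
  \sum_j f ((j, i), false) = \sum_j f ((j, i'), false).
Proof.
move=> fR i0 i'0.
have qmul a : qr a -> \sum_j f ((j, i), false) = \sum_j f ((j, a * i), false).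
  by move=> qa; apply: eq_bigr => j _; rewrite -(paley_pmu fR _ qa).
have ii'0 : i' / i != 0 by rewrite mulf_neq0 ?invr_eq0.
have [q|q] := boolP (qr (i' / i)); first by rewrite (qmul _ q) divfK.
have qn : qr (- (i' / i)) by rewrite qrN.
rewrite (qmul _ qn) mulNr divfK // (reindex_inj oppr_inj) /=.
by apply: eq_bigr => j _; rewrite (paley_pnu fR).
Qed.

(** Each half of the convolution pairs rotations with reflections, whose class ignores [j]. By
    [sum_rot] the sums over [j] take a single value for [i != 0], so [d] survives only in the term
    [i = 0], through [qr d]. *)
Let conv_refl (f1 f2 : gT -> int) l d l' d' : qr d = qr d' ->
  class_fun paley_rel f1 -> class_fun paley_rel f2 ->
  \sum_k f1 k * f2 ((((l, d), true) : gT) * k^-1)%g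
   = \sum_k f1 k * f2 ((((l', d'), true) : gT) * k^-1)%g.
Proof.
move=> dd' f1R f2R.
have sum_const (f f' : gT -> int) (s : 'F_p -> 'F_p) : injective s ->
    class_fun paley_rel f ->
    \sum_i \sum_j f ((j, i), false) * f' ((0, s i), true) =
    (\sum_j f ((j, 1), false)) * (\sum_i f' ((0, i), true))
    + (\sum_j f ((j, 0), false) - \sum_j f ((j, 1), false)) * f' ((0, s 0), true).
  move=> s_inj fR; under eq_bigr do rewrite -mulr_suml.
  rewrite (bigD1 0) //= (eq_bigr (fun i => (\sum_j f ((j, 1), false)) * f' ((0, s i), true))).
    rewrite [X in _ = _ * X + _](reindex_inj s_inj) /= mulr_sumr.
    by rewrite [in RHS](bigD1 0) //=; ring.
  by move=> i i0; rewrite (sum_rot fR i0 (oner_neq0 _)).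
have convE x y : \sum_k f1 k * f2 ((((x, y), true) : gT) * k^-1)%g =
    \sum_i \sum_j f1 ((j, i), false) * f2 ((0, y + i), true) +
    \sum_i \sum_j f2 ((j, i), false) * f1 ((0, y - i), true).
  rewrite sum_dih !sum_pair; congr (_ + _).
    apply: eq_bigr => i _; apply: eq_bigr => j _; rewrite dihV dihM opprK pairD.
    by congr (_ * _); apply: paley_refl.
  rewrite (reindex_inj (can_inj (fun i => subKr y i))) /=.
  apply: eq_bigr => i _; rewrite (reindex_inj (can_inj (fun j => subKr x j))) /=.
  apply: eq_bigr => j _; rewrite dihV dihM /= pairB !subKr mulrC.
  by congr (_ * _); apply: paley_refl.
rewrite !convE !(sum_const _ _ (fun i => _ + i)) //; try exact: addrI.
rewrite !(sum_const _ _ (fun i => _ - i)) //; try exact: (can_inj (subKr _)).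
by rewrite !addr0 !subr0 (paley_refl f1R 0 0 dd') (paley_refl f2R 0 0 dd').
Qed.

(** A function of a boolean is affine in its indicator, so only the number of [i] with [i] and
    [x + i] both squares depends on [x]; translation by [d] shows it even. *)
Let sum_qr_sym (c1 c2 : bool -> int) (d : 'F_p) :
  \sum_i c1 (qr i) * c2 (qr (d + i)) = \sum_i c1 (qr i) * c2 (qr (- d + i)).
Proof.
have cE (c : bool -> int) b : c b = c false + (c true - c false) * b%:R.
  by case: b; rewrite ?mulr1 ?mulr0 ?addr0 // addrC subrK.
have sumE x : \sum_i c1 (qr i) * c2 (qr (x + i)) =
    \sum_(i : 'F_p) c1 (qr i) * c2 false + c1 false * (c2 true - c2 false) * (\sum_i (qr i)%:R)
     + (c1 true - c1 false) * (c2 true - c2 false) * \sum_i (qr i && qr (x + i))%:R.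
  rewrite [X in _ + _ * X + _](reindex_inj (addrI x)) /= !mulr_sumr -!big_split /=.
  apply: eq_bigr => i _; rewrite (cE c2 (qr (x + i))) (cE c1 (qr i)).
  by case: (qr i) (qr (x + i)) => -[]; rewrite /=; ring.
rewrite !sumE; congr (_ + _ * _); rewrite [RHS](reindex_inj (addrI d)) /=.
by apply: eq_bigr => i _; rewrite addKr andbC.
Qed.

Let conv_pnu (f1 f2 : gT -> int) j d :
  class_fun paley_rel f1 -> class_fun paley_rel f2 ->
  let g : gT := ((j, d), false) in
  \sum_k f1 k * f2 (g * k^-1)%g = \sum_k f1 k * f2 (pnu g * k^-1)%g.
Proof.
move=> f1R f2R g; rewrite !sum_dih; congr (_ + _).
  rewrite [RHS](reindex_inj oppr_inj) /=; apply: eq_bigr => -[j' i'] _.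
  rewrite /g /pnu !dihV !dihM /=; congr (_ * _); first exact/esym/(paley_pnu f1R).
  by rewrite pairB -(paley_pnu f2R) !opprD.
pose c f b := (f : gT -> int) ((0, if b then 1 else 0), true).
have cE f x : class_fun paley_rel f -> f ((x.1, x.2), true) = c f (qr x.2).
  by move=> fR; apply: paley_refl => //; case: ifP; rewrite ?qr1 ?qr0.
rewrite !sum_pair.
transitivity (\sum_i \sum_(j' : 'Z_4) c f1 (qr i) * c f2 (qr (d + i))).
  apply: eq_bigr => i _; apply: eq_bigr => j' _.
  by rewrite /g dihV dihM /= (cE _ (j', i)) // pairD (cE _ (j + j', d + i)).
transitivity (\sum_i \sum_(j' : 'Z_4) c f1 (qr i) * c f2 (qr (- d + i))).
  rewrite exchange_big [RHS]exchange_big; apply: eq_bigr => j' _; exact: sum_qr_sym.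
apply: eq_bigr => i _; apply: eq_bigr => j' _.
by rewrite /g /pnu dihV dihM /= (cE _ (j', i)) // pairD (cE _ (- j + j', - d + i)).
Qed.

Lemma paley_rel_Sring : Sring_rel paley_rel.
Proof.
split.
- have pmu1 a : pmu a 1%g = 1%g by rewrite /pmu /= mulr0.
  move=> g /orP[] /or3P[/existsP[a /andP[a0 /eqP E]]|/andP[ng /eqP E]|].
  + by rewrite E pmu1.
  + by rewrite E /pnu /= !oppr0.
  + by [].
  + by rewrite -(pmuK (qr_neq0 a0) g) -E pmu1.
  + case: g ng E => [[j i] []]; rewrite /pnu /= => _ E; first by case/(congr1 snd): E.
    have Ej : 0 = - j := congr1 (fun h : gT => h.1.1) E.
    have Ei : 0 = - i := congr1 (fun h : gT => h.1.2) E.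
    by rewrite -(opprK j) -(opprK i) -Ej -Ei !oppr0.
  + by rewrite andbF.
- by move=> f fR g h; apply: paley_relV.
move=> f1 f2 f1R f2R g h /or3P[/existsP[a /andP[qa /eqP->]]|/andP[ng /eqP->]|].
- apply: (eq_conv (phi := pmu a)) => [|k|k]; first exact: can_inj (pmuK (qr_neq0 qa)).
    exact: paley_pmu.
  by rewrite -pmuV -pmuM paley_pmu.
- by case: g ng => [[j d] []] //= _; apply: conv_pnu.
case: g h => [[j i] e] [[j' i'] e'] /and3P[/= -> -> /eqP E].
exact: (conv_refl _ _ E f1R f2R).
Qed.

(** The last component is the tournament: squares for [j = 1], nonsquares for [j = -1], since [pnu]
    negates both coordinates. For even [j] it fuses [i] with [- i] and no orientation is left. *)
Definition paley_color (g : gT) : bool * bool * {set 'Z_4} * bool :=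
  if g.2 then (true, qr g.1.2, set0, false)
  else (false, g.1.2 == 0, [set g.1.1; - g.1.1],
        (g.1.2 != 0) && (odd g.1.1 && (qr g.1.2 == (g.1.1 == 1)))).

Lemma paley_color_class : class_fun paley_rel paley_color.
Proof.
move=> [[j i] e] h /or3P[/existsP[a /andP[qa /eqP->]] | /andP[ng /eqP->]|].
- by rewrite /paley_color /= (qrMl _ qa) mulf_eq0 (negPf (qr_neq0 qa)).
- rewrite /paley_color /pnu /=; case: e ng => //= _.
  rewrite oppr_eq0 opprK; congr (_, _, _, _); first by rewrite setUC.
  have [->|i0] //= := eqVneq i 0; rewrite qrN //.
  by case: j => -[|[|[|[|]]]] //= ?; case: qr.
by case: h => [[j' i'] e'] /and3P[/= -> -> /eqP E]; rewrite /paley_color /= E.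
Qed.

(* The points of the C_p-blocks are permuted by an (anti)automorphism of the
   Paley tournament, while the reflections force it to preserve the family of
   translates of the set of squares; these two families of sets only agree for
   p = 3. *)
Lemma Schur_dihedral_paley n : (0 < n)%N -> (4 * p %| n)%N ->
  ~ Schur_group ('D_(2 * n))%type.
Proof.
move=> n_gt0 p4n schurD; have p_gt1 := prime_gt1 p_pr.
have n_gt1 : (1 < n)%N.
  by apply: leq_trans (dvdn_leq n_gt0 p4n); rewrite (leq_trans p_gt1) // leq_pmull.
have pd : pdiv p = p by exact: pdiv_id.
have co : coprime 4 (pdiv p).
  by rewrite pd (_ : 4 = 2 ^ 2)%N // coprimeXl // coprime2n pE /= oddM.
have pd_gt1 : (1 < pdiv p)%N by rewrite pd.
have pd4n : (4 * pdiv p %| n)%N by rewrite pd.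
pose x : gT := ((0, 1), false).
have Rx : paley_rel x (pnu x) by rewrite /paley_rel /= eqxx orbT.
have [k [k_inj k1 kx kP]] :=
  Schur_dihedral_class_fun schurD n_gt1 (isT : 1 < 4)%N pd_gt1 co pd4n paley_rel_Sring Rx.
have kC g h : paley_color (k h * (k g)^-1)%g = paley_color (h * g^-1)%g.
  exact: kP paley_color_class g h.
have kC1 g : paley_color (k g) = paley_color g.
  by have := kC 1%g g; rewrite k1 invg1 !mulg1.
have k0 u : exists v, k ((0, u), false) = ((0, v), false).
  have := kC1 ((0, u), false); case: (k _) => [[j i] []]; rewrite /paley_color //=.
  rewrite oppr0 => -[_ E _]; exists i.
  have : j \in [set 0; 0] by rewrite -E !inE eqxx.
  by rewrite !inE orbb => /eqP->.
pose pi u := (k ((0, u), false)).1.2.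
have kpi u : k ((0, u), false) = ((0, pi u), false).
  by rewrite /pi; have [v ->] := k0 u.
have pi_inj : injective pi.
  by move=> u v E; have := kpi v; rewrite -E -kpi => /k_inj/(congr1 (fun g : gT => g.1.2)).
have pi0 : pi 0 = 0 by rewrite /pi k1.
have pi1 : pi 1 = -1 by rewrite /pi -/x kx.
have pi_neq0 u : u != 0 -> pi u != 0 by rewrite -[X in _ -> _ != X]pi0 (inj_eq pi_inj).
have [ep kep] : exists ep, k ((1, 0), false) = ((ep, 0), false).
  have := kC1 ((1, 0), false); case: (k _) => [[j i] []]; rewrite /paley_color /= ?eqxx //.
  by case=> i0 _ _; exists j; rewrite (eqP i0).
have kep1 u : k ((1, u), false) = ((ep, pi u), false).
  have := kC ((1, 0), false) ((1, u), false); have := kC ((0, u), false) ((1, u), false).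
  rewrite kep kpi; case: (k _) => [[j i] []]; rewrite /paley_color !dihV !dihM /= ?pairB //.
  rewrite subrr eqxx => -[/eqP + _ _]; move/eqP; rewrite subr_eq0 => /eqP->.
  rewrite ?pairB /= !subrr !oppr0 => -[_ E _]; have : j - ep \in [set 0; 0].
    by rewrite -E !inE eqxx.
  by rewrite !inE orbb subr_eq0 => /eqP->.
(* At [y = 1] the image [pi 1 = -1] is a nonsquare, which forces [ep] to be odd and different from
   1. *)
have pi_anti u : u != 0 -> qr (pi u) = ~~ qr u.
  have epP y : y != 0 -> odd ep && (qr (pi y) == (ep == 1)) = qr y.
    move=> y0; have := kC1 ((1, y), false); rewrite kep1 /paley_color /= y0 (pi_neq0 _ y0).
    by case=> _ _ ->; case: qr.
  have := epP _ (oner_neq0 _); rewrite pi1 qrN ?oner_neq0 // qr1.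
  by case/andP=> ep_odd /eqP/esym ep1 /epP; rewrite ep_odd ep1 => <-; case: qr.
have [v qv] : exists v, forall u, qr (pi u + v) = qr u.
  pose h : gT := ((0, 0), true).
  have := kC1 h; have := fun u => kC ((0, u), false) h.
  case: (k h) => [[l v] []] hC; rewrite /paley_color /=; last by case.
  move=> _; exists v => u; have := hC u; rewrite kpi /h /paley_color !dihV !dihM /=.
  by rewrite !opprK add0r addrC => -[].
have qvN y : qr (y + v) = qr (- y).
  rewrite -(f_invF pi_inj y) qv; have [->|u0] := eqVneq (invF pi_inj y) 0.
    by rewrite pi0 oppr0.
  by rewrite qrN ?pi_neq0 // pi_anti // negbK.
have natF_neq0 c : (0 < c < p)%N -> c%:R != 0 :> 'F_p.
  by case/andP=> c0 cp; rewrite -(dvdn_pcharf (pchar_Fp p_pr)) gtnNdvd.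
(* Multiplication by 4 permutes the nonzero squares, so [3 * S = 0], and 3 is invertible as
   [p >= 7]. *)
pose S := \sum_(y : 'F_p | qr y) y; have S0 : S = 0.
  have two0 : 2%:R != 0 :> 'F_p by apply: natF_neq0; rewrite pE; lia.
  have q4 : qr (2%:R * 2%:R) by rewrite qrM // eqxx.
  have S4 : 2%:R * 2%:R * S = S.
    rewrite [RHS](reindex_inj (mulfI (qr_neq0 q4))) /= mulr_sumr.
    by apply: eq_bigl => y; rewrite qrMl.
  have : 3%:R * S == 0 by rewrite -[X in _ == X](subrr S) -{2}S4; apply/eqP; ring.
  by rewrite mulf_eq0 (negPf (natF_neq0 3 _)) ?pE; [move/eqP | lia].
(* With [S = 0] the left side is [- v] times the number of squares and the right side is 0; hence
   [v = 0], and [qvN] would make -1 a square. *)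
have : \sum_(y : 'F_p | qr (y + v)) y = \sum_(y : 'F_p | qr (- y)) y.
  exact: eq_bigl qvN.
rewrite [LHS](reindex_inj (addIr (- v))) [RHS](reindex_inj oppr_inj) /=.
under eq_bigl do rewrite subrK; under [RHS]eq_bigl do rewrite opprK.
rewrite sumrB sumrN -/S S0 sub0r sumr_const oppr0 => /eqP.
rewrite oppr_eq0 -mulr_natr mulf_eq0 (negPf (natF_neq0 _ _)) ?orbF => [/eqP v0|].
  by have := qvN 1; rewrite v0 addr0 qrN ?oner_neq0 //; case: (qr 1).
apply/andP; split; first by apply/card_gt0P; exists 1; exact: qr1.
rewrite -[X in (_ < X)%N](card_Fp p_pr) -cardsT; apply: proper_card.
apply/properP; split; first by apply/subsetP=> y _; rewrite inE.
by exists 0; rewrite ?inE //; apply/negP=> q0; have := qr0; rewrite [qr 0]q0.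
Qed.

End PaleyDihedral.

(** * Multiples of 24 and 36 *)

Definition nat_pairs (m n : nat) : seq (nat * nat) :=
  [seq (u, v) | u <- iota 0 m, v <- iota 0 n].

Lemma mem_nat_pairs m n u v : ((u, v) \in nat_pairs m n) = (u < m)%N && (v < n)%N.
Proof.
apply/allpairsP/andP=> [[[u' v'] /= [+ + [-> ->]]]|[um vn]].
  by rewrite !mem_iota.
by exists (u, v); rewrite /= !mem_iota.
Qed.

Section ColorTable.

Variables (r' s' : nat) (tab : seq (seq nat)).

Local Notation r := r'.+2.
Local Notation s := s'.+2.
Local Notation gT := (dih ('Z_r * 'Z_s)%type).

(** Plain naturals replace ordinals, so that [vm_compute] handles no proof components. *)
Definition cdih : Type := nat * nat * bool.

Definition cmul (g h : cdih) : cdih :=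
  let: (u, v, e) := g in let: (u', v', e') := h in
  ((u + if e then r - u' else u') %% r, (v + if e then s - v' else v') %% s, e (+) e')%N.
Definition cinv (g : cdih) : cdih :=
  let: (u, v, e) := g in if e then g else ((r - u) %% r, (s - v) %% s, e)%N.
Definition celts : seq cdih :=
  [seq (w, e) | w <- nat_pairs r s, e <- [:: false; true]].
(* Row e * r + u, column v of the table holds the color of x1^u x2^v y^e. *)
Definition ccol (g : cdih) : nat :=
  let: (u, v, e) := g in nth 0 (nth [::] tab (e * r + u)) v.

Definition code (g : gT) : cdih := (nat_of_ord g.1.1, nat_of_ord g.1.2, g.2).
Definition decode (g : cdih) : gT :=
  let: (u, v, e) := g in ((inZp u, inZp v), e).

Lemma codeM g h : code (g * h)%g = cmul (code g) (code h).
Proof.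
case: g h => [[u v] e] [[u' v'] e']; rewrite dihM /code /=.
by case: e; rewrite //= !modnDmr.
Qed.

Lemma codeV g : code g^-1%g = cinv (code g).
Proof. by case: g => [[u v] []]. Qed.

Lemma mem_celts u v e : ((u, v, e) \in celts) = (u < r)%N && (v < s)%N.
Proof.
rewrite -mem_nat_pairs; apply/allpairsP/idP => [[[w e'] [wP _ [-> _]]] //|uv].
by exists ((u, v), e); split=> //; case: e.
Qed.

Lemma code_mem g : code g \in celts.
Proof. by rewrite mem_celts !ltn_ord. Qed.

Lemma decodeK : {in celts, cancel decode code}.
Proof.
by move=> [[u v] e]; rewrite mem_celts => /andP[ur vs]; rewrite /code /= !modn_small.
Qed.

Lemma code_inj : injective code.
Proof. by move=> [[u v] e] [[u' v'] e'] [/val_inj-> /val_inj-> ->]. Qed.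

Lemma perm_celts : perm_eq (map code (enum {: gT})) celts.
Proof.
apply: uniq_perm => [||g].
- by rewrite (map_inj_uniq code_inj) enum_uniq.
- apply: allpairs_uniq => //; last by move=> [w e] [w' e'] _ _ [-> ->].
  by apply: allpairs_uniq; rewrite ?iota_uniq // => -[u v] [u' v'] _ _ [-> ->].
apply/mapP/idP => [[h _ ->]|gP]; first exact: code_mem.
by exists (decode g); rewrite ?decodeK ?mem_enum.
Qed.

Lemma sum_code (F : cdih -> int) : \sum_g F (code g) = \sum_(g <- celts) F g.
Proof. by rewrite -(perm_big _ perm_celts) big_map big_enum. Qed.

Definition color_rel : rel gT := fun g h => ccol (code g) == ccol (code h).

(** The multiplicities in this multiset are all the structure constants at [g], so one [perm_eq]
    with the representative of the colour verifies them together. *)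
Definition color_pairs (g : cdih) : seq (nat * nat) :=
  [seq (ccol h, ccol (cmul g (cinv h))) | h <- celts].
Definition color_repr (g : cdih) : cdih :=
  nth g celts (find (fun h => ccol h == ccol g) celts).

Definition color_check : bool :=
  all (fun g => [&& (ccol g == ccol (0, 0, false)) ==> (g == (0, 0, false)),
      ccol (cinv g) == ccol (cinv (color_repr g))
    & perm_eq (color_pairs g) (color_pairs (color_repr g))]) celts.

(* A conditional rather than a conjunction, which vm_compute would not
   short-circuit. *)
Fixpoint color_extends (pts : seq cdih) (acc : seq (cdih * cdih)) : bool :=
  if pts is g :: pts' then
    has (fun h =>
      if all (fun a => ccol (cmul h (cinv a.2)) == ccol (cmul g (cinv a.1))) acc
      then color_extends pts' ((g, h) :: acc) else false) celts
  else true.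

Lemma color_extends_cons g pts acc : color_extends (g :: pts) acc =
  has (fun h => all (fun a => ccol (cmul h (cinv a.2)) == ccol (cmul g (cinv a.1))) acc
    && color_extends pts ((g, h) :: acc)) celts.
Proof. by apply: eq_has => h; case: all. Qed.

Lemma color_check_Sring : color_check -> Sring_rel color_rel.
Proof.
move/allP=> chk; have chk' g := chk _ (code_mem g).
have reprE g h : color_rel g h -> color_repr (code g) = color_repr (code h).
  by move=> /eqP gh; rewrite /color_repr gh; apply: set_nth_default; rewrite -has_find; apply/hasP; exists (code h); rewrite ?code_mem.
split.
- move=> g; rewrite /color_rel [X in _ || X]eq_sym orbb => /eqP/esym/eqP g1.
  have /and3P[/implyP/(_ g1)/eqP gE _ _] := chk' g.
  by apply: code_inj; rewrite gE.
- move=> f fR g h gh; apply: fR; rewrite /color_rel !codeV.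
  have /and3P[_ /eqP-> _] := chk' g; have /and3P[_ /eqP-> _] := chk' h.
  by rewrite (reprE g h gh).
move=> f1 f2 f1R f2R g h gh.
pose c (f : gT -> int) x := oapp f 0 [pick y | ccol (code y) == x].
have cE f y : class_fun color_rel f -> f y = c f (ccol (code y)).
  move=> fR; rewrite /c; case: pickP => [z /eqP yz|/(_ y)]; last by rewrite eqxx.
  by apply: fR; apply/eqP.
have convE x : \sum_k f1 k * f2 (x * k^-1)%g =
    \sum_(a <- color_pairs (code x)) c f1 a.1 * c f2 a.2.
  rewrite big_map -sum_code; apply: eq_bigr => k _ /=.
  by rewrite (cE f1) // (cE f2) // codeM codeV.
rewrite !convE; apply: perm_big.
have /and3P[_ _ gP] := chk' g; have /and3P[_ _ hP] := chk' h.
by rewrite (perm_trans gP) // (reprE g h gh) perm_sym.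
Qed.

(** A genuine [k] offers the search a valid image [k g] at each step, so failure on a few points
    already rules [k] out. *)
Lemma color_extendsP (k : gT -> gT) (pts : seq cdih) (hs : seq gT) :
  (forall g h, ccol (code (k h * (k g)^-1)%g) = ccol (code (h * g^-1)%g)) ->
  all (mem celts) pts -> color_extends pts [seq (code h, code (k h)) | h <- hs].
Proof.
move=> kP; elim: pts hs => [//|g pts IHpts hs /andP[gP ptsP]].
rewrite color_extends_cons; apply/hasP; exists (code (k (decode g))); first exact: code_mem.
apply/andP; split; last by rewrite -{1}(decodeK gP); apply: (IHpts (decode g :: hs)).
apply/allP=> _ /mapP[h _ ->]; rewrite [(_, _).2]/= [(_, _).1]/=.
by rewrite -{2}(decodeK gP) -!codeV -!codeM kP.
Qed.

Lemma Schur_dihedral_table n (x x' : gT) (pts : seq cdih) :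
  (0 < n)%N -> coprime r s -> (r * s %| n)%N ->
  color_check -> ccol (code x) = ccol (code x') -> all (mem celts) pts ->
  ~~ color_extends pts [:: (code x, code x'); (code 1%g, code 1%g)] ->
  ~ Schur_group ('D_(2 * n))%type.
Proof.
move=> n_gt0 co rs_n chk xx' ptsP /negP no_ext schurD; apply: no_ext.
have n_gt1 : (1 < n)%N by apply: leq_trans (dvdn_leq n_gt0 rs_n).
have Rx : color_rel x x' by apply/eqP.
have [k [_ k1 kx kP]] := Schur_dihedral_class_fun schurD n_gt1
  (isT : 1 < r)%N (isT : 1 < s)%N co rs_n (color_check_Sring chk) Rx.
have kC g h : ccol (code (k h * (k g)^-1)%g) = ccol (code (h * g^-1)%g).
  by apply: (kP _ (fun g => ccol (code g))) => ? ? /eqP.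
by have := color_extendsP [:: x; 1%g] kC ptsP; rewrite /= kx k1.
Qed.

End ColorTable.
Definition tab24 : seq (seq nat) :=
  [:: [:: 0; 7; 7]; [:: 3; 1; 6]; [:: 5; 2; 2]; [:: 3; 1; 6];
      [:: 8; 4; 4]; [:: 3; 6; 1]; [:: 5; 2; 2]; [:: 3; 6; 1];
      [:: 9; 9; 9]; [:: 10; 10; 10]; [:: 9; 9; 9]; [:: 10; 10; 10];
      [:: 11; 11; 11]; [:: 10; 10; 10]; [:: 11; 11; 11]; [:: 10; 10; 10]].

Definition tab36 : seq (seq nat) :=
  [:: [:: 0; 1; 2; 6; 1; 2; 6; 1; 2]; [:: 5; 1; 2; 3; 1; 2; 3; 1; 2];
      [:: 7; 1; 2; 4; 1; 2; 4; 1; 2]; [:: 5; 1; 2; 3; 1; 2; 3; 1; 2];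
      [:: 8; 11; 12; 8; 11; 10; 8; 11; 13]; [:: 8; 9; 10; 8; 9; 12; 8; 9; 13];
      [:: 8; 9; 10; 8; 9; 12; 8; 9; 13]; [:: 8; 11; 12; 8; 11; 10; 8; 11; 13]].

Lemma Schur_dihedral24 n : (0 < n)%N -> (24 %| n)%N -> ~ Schur_group ('D_(2 * n))%type.
Proof.
move=> n_gt0 n24.
(* The parameters 6 and 1 encode the moduli 8 and 3. The chosen [x] and [x'] share colour 10, and
   the search fails on the four listed points. *)
apply: (@Schur_dihedral_table 6 1 tab24 n ((1, 1), true) ((3%:R, 0), true)
  [:: (4, 0, false); (5, 1, true); (1, 1, false); (7, 1, false)]%N n_gt0 _ n24); by vm_compute.
Qed.

Lemma Schur_dihedral36 n : (0 < n)%N -> (36 %| n)%N -> ~ Schur_group ('D_(2 * n))%type.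
Proof.
move=> n_gt0 n36.
apply: (@Schur_dihedral_table 2 7 tab36 n ((2%:R, 1), false) ((1, 1), false)
  [:: (2, 0, false); (0, 1, false); (1, 1, false); (3, 1, false); (1, 1, true);
      (0, 4, true)]%N n_gt0 _ n36); by vm_compute.
Qed.

(** * Conclusion *)

Lemma Schur_dihedral_4p n p : (0 < n)%N -> prime p -> (4 < p)%N -> (4 * p %| n)%N ->
  ~ Schur_group ('D_(2 * n))%type.
Proof.
move=> n_gt0 p_pr p_gt4 p4n.
have p_odd : odd p by case: (even_prime p_pr) => // p2; rewrite p2 in p_gt4.
have [p1|p3] : (p = (4 * (p %/ 4)).+1 \/ p = (4 * (p %/ 4)).+3)%N by lia.
  have [z [eta [z_prim etaE etaM eta1]]] := quartic_log p_pr p1.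
  exact: (Schur_dihedral_quartic p_pr p1 z_prim etaE etaM eta1 n_gt0 p4n).
by apply: (Schur_dihedral_paley p_pr p3) => //; lia.
Qed.

Lemma coprime_primes p q : prime p -> prime q -> p != q -> coprime p q.
Proof. by move=> p_pr q_pr pq; rewrite prime_coprime // dvdn_prime2. Qed.

Section SchurDihedralFactors.

Variable n : nat.
Hypotheses (n_gt0 : (0 < n)%N) (schurD : Schur_group ('D_(2 * n))%type).

Lemma no_twisted_factors a b c d : (2 < a)%N -> (2 < b)%N -> (2 < c)%N -> (1 < d)%N ->
  coprime (a * d) (b * c) -> (a * d %| n)%N -> (b * c %| n)%N -> False.
Proof.
move=> a_gt2 b_gt2 c_gt2 d_gt1 co adn bcn.
apply: (Schur_dihedral_twisted a_gt2 b_gt2 c_gt2 d_gt1 n_gt0 co) schurD.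
by rewrite Gauss_dvd // adn bcn.
Qed.

(** Here [b = c = x]; the smaller prime [p], possibly 2, must serve as [d], and [q > p] as [a]. *)
Lemma no_square_three_primes x p q : prime x -> prime p -> prime q -> (2 < x)%N ->
  (p < q)%N -> x != p -> x != q -> (p %| n)%N -> (q %| n)%N -> (x ^ 2 %| n)%N -> False.
Proof.
move=> x_pr p_pr q_pr x_gt2 pq xp xq pn qn xn; have p_gt1 := prime_gt1 p_pr.
apply: (@no_twisted_factors q x x p) => //.
- exact: leq_ltn_trans pq.
- by rewrite !coprimeMl !coprimeMr !coprime_primes // eq_sym.
- by rewrite Gauss_dvd ?qn // coprime_primes // neq_ltn pq orbT.
Qed.

End SchurDihedralFactors.

Theorem theorem1p2 (n : nat) (n_ge3 : (3 <= n)%N)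
    (D2n_Schur : Schur_group ('D_(2 * n))%type) :
  [/\ (size (primes n) <= 3)%N,
      size (primes n) = 2%N ->
        (exists p q k : nat,
           [/\ prime p, prime q, odd q, (0 < k)%N & n = (p * q ^ k)%N])
        \/ n = 12%N
    & size (primes n) = 3%N ->
        exists p q r : nat,
          [/\ prime p, prime q, prime r & n = (p * q * r)%N]].
Proof.
have n_gt0 : (0 < n)%N by apply: ltn_trans n_ge3.
have nE := prod_prime_decomp n_gt0; rewrite prime_decompE big_map /= in nE.
have sq_dvd p : prime p -> (2 <= logn p n)%N -> (p ^ 2 %| n)%N.
  by move=> p_pr; rewrite pfactor_dvdn.
have : all prime (primes n) by apply/allP=> p; rewrite mem_primes => /and3P[].
have : all (fun p => p %| n)%N (primes n) by apply/allP=> p; rewrite mem_primes => /and3P[].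
have : all (fun p => 0 < logn p n)%N (primes n) by apply/allP=> p; rewrite logn_gt0.
move: (sorted_primes n) nE; case: (primes n) => [|p [|q [|r [|t s]]]] //=.
- rewrite !big_cons big_nil andbT => pq.
  set i := logn p n; set j := logn q n => nE /and3P[i_gt0 j_gt0 _] /and3P[pn qn _].
  case/and3P=> p_pr q_pr _; split=> // _.
  have q_odd : odd q.
    by case: (even_prime q_pr) => // q2; have := prime_gt1 p_pr; rewrite q2 in pq; lia.
  have co_pq : coprime p q by rewrite coprime_primes // neq_ltn pq.
  case: (ltngtP i 1) => [||i1]; first by rewrite ltnNge i_gt0.
    move=> i_gt1; have p2n := sq_dvd p p_pr i_gt1.
    case: (even_prime p_pr) => [p2|p_odd].
      (* A larger [q] would give the factor [4q]. Among [2^i 3^j] with [i >= 2], the factors 24 and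
         36 then leave only 12. *)
      have q3 : q = 3%N.
        have [q_gt4|] := ltnP 4 q; last by lia.
        case: (Schur_dihedral_4p n_gt0 q_pr q_gt4) => //.
        by rewrite p2 in p2n co_pq; rewrite (Gauss_dvd _ (coprimeXl 2 co_pq)) p2n qn.
      have i2 : logn 2 n = i by rewrite /i p2.
      have j3 : logn 3 n = j by rewrite /j q3.
      rewrite q3 in qn; right; rewrite nE p2 q3 muln1.
      case: (ltngtP i 2) => [|i_gt2|->]; first by rewrite ltnNge i_gt1.
        case: (@Schur_dihedral24 n) => //; rewrite (@Gauss_dvd 8 3) // qn andbT.
        by rewrite (@pfactor_dvdn 2 3) // i2.
      case: (ltngtP j 1) => [|j_gt1|-> //]; first by rewrite ltnNge j_gt0.
      case: (@Schur_dihedral36 n) => //; rewrite (@Gauss_dvd 4 9) //.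
      by rewrite (@pfactor_dvdn 2 2) // (@pfactor_dvdn 3 2) // i2 j3 i_gt1 j_gt1.
    case: (ltngtP j 1) => [||j1]; first by rewrite ltnNge j_gt0.
      move=> j_gt1; have q2n := sq_dvd q q_pr j_gt1.
      have p_gt2 : (2 < p)%N by rewrite odd_prime_gt2.
      case: (@no_twisted_factors n n_gt0 D2n_Schur p q q p) => //.
      - exact: ltn_trans pq.
      - exact: ltn_trans pq.
      - exact: prime_gt1.
      - by rewrite !coprimeMl !coprimeMr co_pq.
    by left; exists q, p, i; split=> //; rewrite nE j1 muln1 expn1 mulnC.
  by left; exists p, q, j; split=> //; rewrite nE i1 muln1.
- rewrite !big_cons big_nil => /and3P[pq qr _].
  move=> nE /and4P[i_gt0 j_gt0 l_gt0 _] /and4P[pn qn rn _] /and4P[p_pr q_pr r_pr _].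
  have [p_gt1 pr] := (prime_gt1 p_pr, ltn_trans pq qr).
  have q_gt2 : (2 < q)%N by apply: leq_ltn_trans pq.
  have no_sq := no_square_three_primes n_gt0 D2n_Schur.
  split=> // _; exists p, q, r; split=> //.
  have i1 : logn p n = 1%N.
    apply/eqP; rewrite eqn_leq i_gt0 andbT leqNgt; apply/negP=> /(sq_dvd p p_pr) p2n.
    case: (even_prime p_pr) => [p2|p_odd].
      (* From [2 = p < q < r] the largest prime is at least 5, so [4r] divides [n]. *)
      have r_gt4 : (4 < r)%N.
        have [] := (even_prime q_pr, even_prime r_pr); lia.
      case: (Schur_dihedral_4p n_gt0 r_pr r_gt4) => //.
      rewrite p2 in p2n; rewrite (Gauss_dvd n (_ : coprime (2 ^ 2) r)) ?p2n ?rn //.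
      by rewrite coprimeXl // coprime_primes // neq_ltn -p2 pr.
    apply: (no_sq p q r) p2n => //; [exact: odd_prime_gt2 | |]; by rewrite neq_ltn ?pq ?pr.
  have j1 : logn q n = 1%N.
    apply/eqP; rewrite eqn_leq j_gt0 andbT leqNgt; apply/negP=> /(sq_dvd q q_pr) q2n.
    by apply: (no_sq q p r) q2n => //; rewrite neq_ltn ?pq ?qr ?orbT.
  have l1 : logn r n = 1%N.
    apply/eqP; rewrite eqn_leq l_gt0 andbT leqNgt; apply/negP=> /(sq_dvd r r_pr) r2n.
    apply: (no_sq r p q) r2n => //; rewrite ?neq_ltn ?pr ?qr ?orbT //.
    exact: ltn_trans qr.
  by rewrite nE i1 j1 l1 !expn1 muln1 mulnA.
move=> /and4P[pq qr rt _] _ _ /and5P[pn qn rn tn _] /and5P[p_pr q_pr r_pr t_pr _].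
have p_gt1 := prime_gt1 p_pr.
have [pr [qt pt]] := (ltn_trans pq qr, (ltn_trans qr rt, ltn_trans pq (ltn_trans qr rt))).
(* Four distinct primes suffice; the smallest, which may be 2, takes the place of [d]. *)
case: (@no_twisted_factors n n_gt0 D2n_Schur q r t p) => //.
- exact: leq_ltn_trans pq.
- exact: leq_ltn_trans pr.
- exact: leq_ltn_trans pt.
- by rewrite !coprimeMl !coprimeMr !coprime_primes // neq_ltn ?pr ?pt ?qr ?qt.
- by rewrite Gauss_dvd ?qn // coprime_primes // neq_ltn pq orbT.
- by rewrite Gauss_dvd ?rn // coprime_primes // neq_ltn rt.
Qed.
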